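(* Let $g:\mathbb{T}^2\to\mathbb{T}^2$ be a homeomorphism homotopic to the identity, let $\widetilde g:\mathbb{R}^2\to\mathbb{R}^2$ be a lift of $g$, and let $0<\epsilon<1/2$. If $g$ is conservative, or if the rotation set $\rho(\widetilde g)$ has nonempty interior in $\mathbb{R}^2$, then the $\epsilon$-pseudo-orbit rotation set $\rho_{mz}(\widetilde F)$ of $\widetilde g$ is convex.
   Context: $\mathbb{T}^2=\mathbb{R}^2/\mathbb{Z}^2$ and $\pi:\mathbb{R}^2\to\mathbb{T}^2$ is the covering map. A lift of $g$ is a map $\widetilde g:\mathbb{R}^2\to\mathbb{R}^2$ with $\pi\circ\widetilde g=g\circ\pi$. The homeomorphism $g$ is conservative if its nonwandering set is $\Omega(g)=\mathbb{T}^2$. The (Misiurewicz-Ziemian) rotation set of $\widetilde g$ is $$\rho(\widetilde g)=\bigcap_{N}\overline{\bigcup_{n\ge N}\left\{\tfrac{\widetilde g^n(\widetilde p)-\widetilde p}{n}:\widetilde p\in\mathbb{R}^2\right\}}.$$ The $\epsilon$-pseudo-orbit cocycle: let $X=B_\epsilon(0)\subset\mathbb{T}^2$ be the open ball of radius $\epsilon$ centered at $0$, $\Sigma=X^{\mathbb{Z}}$ with the product topology, and $\sigma((x_n)_n)=(x_{n+1})_n$. Define $F:\Sigma\times\mathbb{T}^2\to\Sigma\times\mathbb{T}^2$ by $F(x,p)=(\sigma(x),f_x(p))$ with $f_x(p)=g(p)+x_0$, and let $\widetilde F(x,\widetilde p)=(\sigma(x),\widetilde f_x(\widetilde p))$ be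 the continuous lift to $\Sigma\times\mathbb{R}^2$ such that $\widetilde f_x=\widetilde g$ when $x_0=0$; explicitly, $\widetilde f_x(\widetilde p)=\widetilde g(\widetilde p)+\widetilde x_0$, where $\widetilde x_0$ is the unique lift of $x_0$ in the ball of radius $\epsilon$ about $0$ in $\mathbb{R}^2$. Write $\widetilde f^n_x=\widetilde f_{\sigma^{n-1}(x)}\circ\cdots\circ\widetilde f_{\sigma(x)}\circ\widetilde f_x$. For $n\ge1$ let $D_n=\left\{\frac{\widetilde f^n_x(\widetilde p)-\widetilde p}{n}: x\in\Sigma,\ \widetilde p\in\mathbb{R}^2\right\}$. The $\epsilon$-pseudo-orbit rotation set is $$\rho_{mz}(\widetilde F)=\bigcap_{N\in\mathbb{N}}\overline{\bigcup_{n\ge N}D_n}.$$ *)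

(* Defs.v *)
From HB Require Import structures.
From mathcomp Require Import all_boot all_order all_algebra generic_quotient.
From mathcomp Require Import ring_quotient archimedean.
From mathcomp Require Import all_classical all_reals all_analysis.
Import Quotient.Exports.

Set Implicit Arguments.
Unset Strict Implicit.
Unset Printing Implicit Defensive.

Import Order.TTheory GRing.Theory Num.Theory.
Import numFieldNormedType.Exports.
Local Open Scope classical_set_scope.
Local Open Scope ring_scope.

Section Topology.
Variables (R : realType) (X Y : topologicalType).

Definition homeomorphism (f : X -> Y) : Prop :=
  continuous f /\ exists h : Y -> X, [/\ continuous h, cancel f h & cancel h f].

Definition homotopic (f0 f1 : X -> Y) : Prop :=
  exists H : R * X -> Y,
    [/\ {within `[0, 1]%classic `*` setT, continuous H},
        forall x, H (0, x) = f0 x & forall x, H (1, x) = f1 x].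

Definition nonwandering_set (f : X -> X) : set X :=
  [set p | forall U : set X, nbhs p U ->
     exists n : nat, (0 < n)%N /\ (iter n f @` U) `&` U !=set0].

Definition conservative (f : X -> X) : Prop := nonwandering_set f = setT.

End Topology.
Arguments homotopic R {X Y} f0 f1.

Section Torus.
Variable R : realType.

Definition plane : Type := 'rV[R]_2.
HB.instance Definition _ := NormedModule.on plane.

(* The norm [`| v |] that the library puts on row vectors is the sup norm. *)
Definition enorm (v : plane) : R := Num.sqrt (\sum_(i < 2) v ord0 i ^+ 2).

Definition int_lattice : {pred plane} :=
  fun v => [forall i : 'I_2, v ord0 i \is a Num.int].

Fact int_lattice_zmod_closed : zmod_closed int_lattice.
Proof.
split=> [|u v /forallP uZ /forallP vZ]; apply/forallP => i.
  by rewrite mxE rpred0.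
by rewrite !mxE rpredB.
Qed.
HB.instance Definition _ :=
  GRing.isZmodClosed.Build plane int_lattice int_lattice_zmod_closed.

Definition torus : Type := quotient_topology (Quotient.quot int_lattice).
HB.instance Definition _ := Topological.on torus.
HB.instance Definition _ := Quotient.on torus.

Definition torus_pi (v : plane) : torus := (\pi_torus v)%qT.

Definition torus_dist (p q : torus) : R :=
  inf [set r | exists u v : plane,
    [/\ torus_pi u = p, torus_pi v = q & r = enorm (u - v)]].

Definition torus_ball (p : torus) (eps : R) : set torus :=
  [set q | torus_dist p q < eps].

Definition is_lift (g : torus -> torus) (gt : plane -> plane) : Prop :=
  continuous gt /\ forall v, torus_pi (gt v) = g (torus_pi v).

Definition limit_set (D : nat -> set plane) : set plane :=
  \bigcap_(N in [set N | (0 < N)%N])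
    closure (\bigcup_(n in [set n | (N <= n)%N]) D n).

Definition rotation_set (gt : plane -> plane) : set plane :=
  limit_set (fun n => [set n%:R^-1 *: (iter n gt p - p) | p in setT]).

Definition noise_space (eps : R) : set (int -> torus) :=
  [set x | forall n, torus_ball (torus_pi 0) eps (x n)].

Definition shift (x : int -> torus) : int -> torus := fun n => x (n + 1).

(* Meaningful for [eps <= 2^-1] and [x0] in [torus_ball (torus_pi 0) eps], where
   the set below is a singleton: see [small_liftP] and [small_lift_uniq]. *)
Definition small_lift (eps : R) (x0 : torus) : plane :=
  xget 0 [set v | enorm v < eps /\ torus_pi v = x0].

Section Cocycle.
Variables (gt : plane -> plane) (eps : R).

Definition fiber_map (x : int -> torus) (p : plane) : plane :=
  gt p + small_lift eps (x 0).

Fixpoint fiber_iter (n : nat) (x : int -> torus) (p : plane) : plane :=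
  if n is m.+1 then fiber_map (iter m shift x) (fiber_iter m x p) else p.

Definition displacement_set (n : nat) : set plane :=
  [set v | exists x p, noise_space eps x /\
     v = n%:R^-1 *: (fiber_iter n x p - p)].

Definition pseudo_orbit_rotation_set : set plane := limit_set displacement_set.

End Cocycle.

Lemma torus_piE (u v : plane) :
  torus_pi u = torus_pi v <-> forall i, u ord0 i - v ord0 i \is a Num.int.
Proof.
have -> : (torus_pi u = torus_pi v) <-> u - v \in int_lattice.
  by rewrite Quotient.idealrBE; split=> [uv|/eqP//]; apply/eqP.
split=> [/forallP H i|H]; first by have := H i; rewrite !mxE.
by apply/forallP => i; rewrite !mxE.
Qed.

Lemma coord_le_enorm (v : plane) i : `|v ord0 i| <= enorm v.
Proof.
rewrite -sqrtr_sqr ler_wsqrtr// (bigD1 i)//= lerDl sumr_ge0// => j _.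
exact: sqr_ge0.
Qed.

Lemma small_lift_uniq (eps : R) (u v : plane) : eps <= 2^-1 ->
  enorm u < eps -> enorm v < eps -> torus_pi u = torus_pi v -> u = v.
Proof.
move=> e2 ue ve /torus_piE uv; apply/rowP => i; apply/eqP; rewrite -subr_eq0.
have lt1 : `|u ord0 i - v ord0 i| < 1.
  have -> : 1 = 2^-1 + 2^-1 :> R by rewrite [LHS]splitr div1r.
  rewrite (le_lt_trans (ler_normB _ _))// ltrD//.
    exact: le_lt_trans (coord_le_enorm u i) (lt_le_trans ue e2).
  exact: le_lt_trans (coord_le_enorm v i) (lt_le_trans ve e2).
by apply: contraTT lt1; rewrite -leNgt => /(norm_intr_ge1 (uv i)).
Qed.

Lemma small_liftP (eps : R) (x0 : torus) : torus_ball (torus_pi 0) eps x0 ->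
  enorm (small_lift eps x0) < eps /\ torus_pi (small_lift eps x0) = x0.
Proof.
move=> dx; rewrite /small_lift.
suff [v Pv] : exists v, [set v | enorm v < eps /\ torus_pi v = x0] v.
  exact: (xgetI _ Pv).
have [|_ [u [v [u0 vx ->]]] uve] := inf_lt _ dx.
  exists (enorm (0 - repr x0)), 0, (repr x0); split=> //.
  exact: reprK.
exists (v - u); split.
  rewrite (_ : enorm _ = enorm (u - v))//; congr Num.sqrt.
  by apply: eq_bigr => i _; rewrite !mxE -sqrrN opprB.
rewrite -vx; apply/torus_piE => i; rewrite !mxE.
move/torus_piE : u0 => /(_ i); rewrite !mxE subr0 => ui.
by rewrite addrAC subrr add0r rpredN.
Qed.

End Torus.

(* Main.v *)
Require Import Defs.
From mathcomp Require Import all_boot all_order all_algebra.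
From mathcomp Require Import archimedean.
From mathcomp Require Import all_classical all_reals all_analysis.
From mathcomp Require Import zify ring lra.
Import Order.TTheory GRing.Theory Num.Theory.
Import numFieldNormedType.Exports.

(** Call x_0, x_1, ... a pseudo-orbit when every x_(i+1) - gt x_i is a noise
vector, i.e. has Euclidean norm less than [eps]; the rotation set collects the
limits of (x_n - x_0) / n.

The loops at a point e, that is the pairs (n, k) such that k is an integer
vector and some pseudo-orbit goes from e to e + k in n steps, form a semigroup.
Therefore the closure of the quotients k / n is convex, and repeating a loop
shows that it lies in the rotation set. So the rotation set is convex as soon as
some e has the property that every pseudo-orbit agrees with a loop at e up to a
bounded error in length and in displacement ([convex_of_near_loop]).

A set of the plane is called [full] when it contains a connected set that meets
its translates by two independent integer vectors. Periodic copies of such a set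
form a net of horizontal and vertical curves, so a connected set that avoids it
is bounded ([full_bounded]); this planar fact comes from a Sperner argument on
grids ([rainbow_square]). A [hub] is a point e lying on a loop such that the
points that lead to e, and the points to which e leads, form full sets modulo
integer vectors. A hub has the required property ([redirect_end],
[hub_convex]). Indeed suppose that a pseudo-orbit x_0, ..., x_n reaches a point
x_i from which e can be reached in about n - i steps, whereas this fails for
x_(i+1). On a segment inside the noise ball around gt x_i there is then a point
z that can reach e in about n - i steps, while no point between x_(i+1) and z
can do it sooner. The futures of that segment after n - i - 1 steps form a
connected set of points that are not close in time to e. That set is bounded,
hence a pseudo-orbit from z to e follows x_(i+1), ..., x_n at bounded distance
and then joins e quickly. This redirects the end of a pseudo-orbit to e, and
the same argument for the inverse homeomorphism redirects its beginning.

It remains to find a hub. If the homeomorphism is conservative, noise closes up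
the orbits near any point and even moves that point to all nearby positions;
walking along segments, any point can be reached from any other, and every point
is a hub ([conservative_hub]). If the rotation set of gt has interior, consider
the future of a point x, the set of points that can be reached from x modulo
integer vectors, and a component U of it containing an iterate of x. By the
pigeonhole principle some gt^m - l maps U into itself. If U meets two
independent translates of itself, the future is full. If U meets translates in
one direction only, U is an invariant strip that no orbit can cross, and all
rotation vectors lie on a line ([strip_not_spreading]). Otherwise U is bounded
and the orbit of x rotates like a rational vector taken from a finite set
([future_dichotomy]). Now let an orbit have no point whose past and future are
both full. The property of having a full past persists forwards, so the orbit
splits into a first part without full pasts and a second part without full
futures, and its displacement is a combination of two vectors from a finite
set. Finitely many lines do not cover an open set ([open_avoids_lines]), which
gives a hub ([exists_hub]). *)

Set Implicit Arguments.
Unset Strict Implicit.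
Unset Printing Implicit Defensive.

Local Open Scope classical_set_scope.
Local Open Scope ring_scope.

(** * Coordinates and integer vectors *)

Section Coordinates.
Variable R : realType.
Implicit Types p q : plane R.

Definition cx p : R := p ord0 0.
Definition cy p : R := p ord0 1.
Definition vec (a b : R) : plane R := \row_(i < 2) if i == 0 then a else b.

Lemma cxD p q : cx (p + q) = cx p + cx q. Proof. by rewrite /cx mxE. Qed.
Lemma cyD p q : cy (p + q) = cy p + cy q. Proof. by rewrite /cy mxE. Qed.
Lemma cxN p : cx (- p) = - cx p. Proof. by rewrite /cx mxE. Qed.
Lemma cyN p : cy (- p) = - cy p. Proof. by rewrite /cy mxE. Qed.
Lemma cxZ (a : R) p : cx (a *: p) = a * cx p. Proof. by rewrite /cx mxE. Qed.
Lemma cyZ (a : R) p : cy (a *: p) = a * cy p. Proof. by rewrite /cy mxE. Qed.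
Lemma cx0 : cx 0 = 0. Proof. by rewrite /cx mxE. Qed.
Lemma cy0 : cy 0 = 0. Proof. by rewrite /cy mxE. Qed.
Lemma cxMn p n : cx (p *+ n) = cx p *+ n.
Proof. by elim: n => [|n IH]; rewrite ?mulr0n ?cx0// !mulrS cxD IH. Qed.
Lemma cyMn p n : cy (p *+ n) = cy p *+ n.
Proof. by elim: n => [|n IH]; rewrite ?mulr0n ?cy0// !mulrS cyD IH. Qed.
Lemma cx_vec a b : cx (vec a b) = a. Proof. by rewrite /cx mxE. Qed.
Lemma cy_vec a b : cy (vec a b) = b. Proof. by rewrite /cy mxE. Qed.
Definition coordE :=
  (cxD, cyD, cxN, cyN, cxZ, cyZ, cx0, cy0, cx_vec, cy_vec, cxMn, cyMn).

Lemma ord2P (i : 'I_2) : i = 0 \/ i = 1.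
Proof. by case: i => [[|[|]]]//= h; [left|right]; apply: val_inj. Qed.

Lemma plane_eq p q : cx p = cx q -> cy p = cy q -> p = q.
Proof. by move=> hx hy; apply/rowP => i; case: (ord2P i) => ->. Qed.

Lemma planeP p q : (p = q) <-> (cx p = cx q /\ cy p = cy q).
Proof. by split=> [->//|[]]; exact: plane_eq. Qed.

Lemma norm_max p : `|p| = Num.max `|cx p| `|cy p|.
Proof.
rewrite [LHS]mx_normrE; apply/eqP; rewrite eq_le; apply/andP; split.
  by apply/bigmax_leP; split=> [|[i j] _ /=]; rewrite le_max ?normr_ge0//;
    rewrite (ord1 i); case: (ord2P j) => ->; rewrite lexx ?orbT.
rewrite ge_max; apply/andP; split.
  exact: (le_bigmax _ (fun ij : 'I_1 * 'I_2 => `|p ij.1 ij.2|) (ord0, 0)).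
exact: (le_bigmax _ (fun ij : 'I_1 * 'I_2 => `|p ij.1 ij.2|) (ord0, 1)).
Qed.

Lemma norm_ltP p (a : R) : (`|p| < a) <-> (`|cx p| < a /\ `|cy p| < a).
Proof. by rewrite norm_max gt_max; split=> [/andP[]|[-> ->]]. Qed.

Lemma norm_leP p (a : R) : (`|p| <= a) <-> (`|cx p| <= a /\ `|cy p| <= a).
Proof. by rewrite norm_max ge_max; split=> [/andP[]|[-> ->]]. Qed.

Lemma enormE p : enorm p = Num.sqrt (cx p ^+ 2 + cy p ^+ 2).
Proof.
rewrite /enorm big_ord_recl big_ord1 /cx /cy; congr (Num.sqrt (_ + p _ _ ^+ 2)).
exact: val_inj.
Qed.

Lemma ball_plane p (r : R) q : ball p r q <-> `|q - p| < r.
Proof. by rewrite -ball_normE /ball_/= distrC. Qed.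

Definition dot (k p : plane R) : R := cx k * cx p + cy k * cy p.
(** Up to the factor given by the length of [k], the coordinate transverse to [k]. *)
Definition det (k p : plane R) : R := cx k * cy p - cy k * cx p.

Definition lat (p : plane R) : Prop := p \in @int_lattice R.

Lemma latP p : lat p <-> cx p \is a Num.int /\ cy p \is a Num.int.
Proof.
split=> [/forallP h|[hx hy]]; first by split; exact: h.
by apply/forallP => i; case: (ord2P i) => ->.
Qed.

Lemma lat0 : lat 0. Proof. exact: rpred0. Qed.
Lemma latD p q : lat p -> lat q -> lat (p + q). Proof. exact: rpredD. Qed.
Lemma latN p : lat p -> lat (- p). Proof. by rewrite /lat rpredN. Qed.
Lemma latB p q : lat p -> lat q -> lat (p - q). Proof. exact: rpredB. Qed.
Lemma latMn p n : lat p -> lat (p *+ n). Proof. exact: rpredMn. Qed.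

Lemma torus_pi_lat p q : torus_pi p = torus_pi q <-> lat (p - q).
Proof.
rewrite torus_piE; split=> [h|/latP[hx hy] i].
  by apply/latP; rewrite /cx /cy !mxE; split; exact: h.
by move: hx hy; rewrite /cx /cy !mxE; case: (ord2P i) => ->.
Qed.

(** Integer vectors are isolated: this is how equality of two lifts is recognised. *)
Lemma lat_small p : lat p -> `|p| < 1 -> p = 0.
Proof.
move=> /latP[hx hy] /norm_ltP[lx ly]; apply: plane_eq; rewrite ?cx0 ?cy0;
  apply/eqP.
  by apply: contraTT lx; rewrite -leNgt => /(norm_intr_ge1 hx).
by apply: contraTT ly; rewrite -leNgt => /(norm_intr_ge1 hy).
Qed.

End Coordinates.

(** * A Sperner argument: discrete curves cross *)

Section Grid.
Variables (n m : nat) (lab : nat -> nat -> bool * bool).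

Let px (l : bool * bool) : int := if l.1 then 0 else (l.2 : nat)%:Z.
Let py (l : bool * bool) : int := if l.1 then 0 else (~~ l.2 : nat)%:Z.
Let e (l l' : bool * bool) : int := px l * py l' - py l * px l'.

(** The first bit says that the colour is 1; when it is not, the second bit
separates colour 2 from colour 3. *)
Definition rainbow (l1 l2 l3 : bool * bool) : bool :=
  [|| l1.1, l2.1 | l3.1] &&
  ([|| ~~ l1.1 && l1.2, ~~ l2.1 && l2.2 | ~~ l3.1 && l3.2] &&
   [|| ~~ l1.1 && ~~ l1.2, ~~ l2.1 && ~~ l2.2 | ~~ l3.1 && ~~ l3.2]).

Let e_triangle l1 l2 l3 : ~~ rainbow l1 l2 l3 -> e l1 l2 + e l2 l3 + e l3 l1 = 0.
Proof. by case: l1 l2 l3 => [[] []] [[] []] [[] []]. Qed.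

Let eN l l' : e l l' = - e l' l. Proof. rewrite /e; ring. Qed.

Let e1l (l l' : bool * bool) : l.1 -> e l l' = 0. Proof. by rewrite /e /px /py => ->; ring. Qed.
(** Colours 1, 2, 3 are placed at the points (0,0), (1,0), (0,1), and an edge from
p to q carries the determinant of p and q. Around a triangle that is not
trichromatic these weights sum to zero, so without trichromatic triangles the
total weight along the boundary of the grid vanishes. The boundary conditions
leave only the side [i = 0], where the weights telescope to the nonzero
difference between its two corners. *)
Lemma rainbow_square :
  (forall j, (j <= m)%N -> ~~ (lab 0 j).1) ->
  (forall j, (j <= m)%N -> (lab n j).1) ->
  (forall i, (i <= n)%N -> (lab i 0).2) ->
  (forall i, (i <= n)%N -> ~~ (lab i m).2) ->
  exists i j, [/\ (i < n)%N, (j < m)%N &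
   rainbow (lab i j) (lab i.+1 j) (lab i.+1 j.+1) \/
   rainbow (lab i j) (lab i.+1 j.+1) (lab i j.+1)].
Proof.
move=> hl hr hb ht; apply: contrapT => hno.
have sq i j : (i < n)%N -> (j < m)%N ->
    e (lab i j) (lab i.+1 j) + e (lab i.+1 j) (lab i.+1 j.+1)
    = e (lab i j.+1) (lab i.+1 j.+1) + e (lab i j) (lab i j.+1).
  move=> hi hj.
  have h1 : ~~ rainbow (lab i j) (lab i.+1 j) (lab i.+1 j.+1).
    by apply/negP => h; apply: hno; exists i, j; split=> //; left.
  have h2 : ~~ rainbow (lab i j) (lab i.+1 j.+1) (lab i j.+1).
    by apply/negP => h; apply: hno; exists i, j; split=> //; right.
  have := e_triangle h1; have := e_triangle h2.
  rewrite (eN (lab i.+1 j.+1) (lab i j)) (eN (lab i.+1 j.+1) (lab i j.+1)).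
  rewrite (eN (lab i j.+1) (lab i j)); lra.
have row j : (j < m)%N -> forall i, (i <= n)%N ->
    \sum_(a < i) e (lab a j) (lab a.+1 j) + e (lab i j) (lab i j.+1)
    = \sum_(a < i) e (lab a j.+1) (lab a.+1 j.+1) + e (lab 0 j) (lab 0 j.+1).
  move=> hj; elim=> [|i IH] hi; first by rewrite !big_ord0.
  rewrite !big_ord_recr /=; have := IH (ltnW hi); have := sq i j hi hj; lra.
have hor j : (j <= m)%N ->
    \sum_(a < n) e (lab a 0) (lab a.+1 0)
    = \sum_(a < n) e (lab a j) (lab a.+1 j) + \sum_(b < j) e (lab 0 b) (lab 0 b.+1).
  elim: j => [|j IH] hj; first by rewrite big_ord0 addr0.
  rewrite big_ord_recr /= IH 1?ltnW//; have := row j hj n (leqnn _).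
  rewrite (e1l (l := lab n j))//; first lra.
  by apply: hr; exact: ltnW.
have e0 (l l' : bool * bool) : l.2 = l'.2 -> e l l' = 0.
  by case: l l' => [[] []] [[] []].
have h0 : \sum_(a < n) e (lab a 0) (lab a.+1 0) = 0.
  apply: big1 => a _; apply: e0; rewrite !hb//; exact: ltnW.
have h1 : \sum_(a < n) e (lab a m) (lab a.+1 m) = 0.
  apply: big1 => a _; apply: e0; have := ht _ (ltn_ord a).
  by have := ht _ (ltnW (ltn_ord a)); do 2 case: (lab _ m).2.
have := hor m (leqnn _); rewrite h0 h1 add0r => hsum.
have tel j : (j <= m)%N -> \sum_(b < j) e (lab 0 b) (lab 0 b.+1)
    = (~~ (lab 0 j).2 : nat)%:Z.
  elim: j => [|j IH] hj; first by rewrite big_ord0 hb.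
  rewrite big_ord_recr /= IH 1?ltnW//.
  have := hl _ hj; have := hl _ (ltnW hj).
  by case: (lab 0 j) => [[] []]; case: (lab 0 j.+1) => [[] []].
by move: hsum; rewrite tel// ht.
Qed.

End Grid.

Section Crossing.
Variable R : realType.

(** The colouring of the grid by the signs of the two coordinates of
u_i - v_j satisfies the boundary conditions of [rainbow_square]; at a
trichromatic triangle both coordinates change sign within one step. *)
Lemma discrete_crossing (n m : nat) (u1 u2 v1 v2 : nat -> R) (eta : R) :
  (forall i, (i < n)%N -> `|u1 i.+1 - u1 i| <= eta /\ `|u2 i.+1 - u2 i| <= eta) ->
  (forall j, (j < m)%N -> `|v1 j.+1 - v1 j| <= eta /\ `|v2 j.+1 - v2 j| <= eta) ->
  (forall j, (j <= m)%N -> u1 0 <= v1 j < u1 n) ->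
  (forall i, (i <= n)%N -> v2 0 < u2 i <= v2 m) ->
  exists i j, [/\ (i <= n)%N, (j <= m)%N,
    `|u1 i - v1 j| <= 2 * eta & `|u2 i - v2 j| <= 2 * eta].
Proof.
move=> hu hv h1 h2.
pose lab i j := (v1 j < u1 i, v2 j < u2 i).
have [] := @rainbow_square n m lab.
- by move=> j /h1 /andP[+ _]; rewrite -leNgt.
- by move=> j /h1 /andP[].
- by move=> i /h2 /andP[].
- by move=> i /h2 /andP[_]; rewrite -leNgt.
move=> i [j [hi hj]].
have [ua ub] := hu _ hi; have [va vb] := hv _ hj.
rewrite /rainbow /lab /= -!leNgt => H.
have near a a' b b' : a \in [:: i; i.+1] -> a' \in [:: i; i.+1] ->
    b \in [:: j; j.+1] -> b' \in [:: j; j.+1] ->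
    [/\ `|u1 a' - u1 a| <= eta, `|u2 a' - u2 a| <= eta,
        `|v1 b' - v1 b| <= eta & `|v2 b' - v2 b| <= eta].
  have eta0 : 0 <= eta by exact: le_trans ua.
  rewrite !inE => /orP[] /eqP -> /orP[] /eqP -> /orP[] /eqP -> /orP[] /eqP ->;
    by split; rewrite ?subrr ?normr0// distrC.
have change (s t s' t' : R) : `|s' - s| <= eta -> `|t' - t| <= eta ->
    s <= t -> t' < s' -> `|s - t| <= 2 * eta.
  by clear; rewrite !ler_norml => /andP[? ?] /andP[? ?] ? ?; apply/andP; split; lra.
have change' (s t s' t' : R) : `|s' - s| <= eta -> `|t' - t| <= eta ->
    t < s -> s' <= t' -> `|s - t| <= 2 * eta.
  by clear; rewrite !ler_norml => /andP[? ?] /andP[? ?] ? ?; apply/andP; split; lra.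
(* p1, p2, p3 are the corners of colours 1, 2, 3; the corner p2 is the witness *)
have rainbow_close p1 q1 p2 q2 p3 q3 :
    [&& p1 \in [:: i; i.+1], p2 \in [:: i; i.+1] & p3 \in [:: i; i.+1]] ->
    [&& q1 \in [:: j; j.+1], q2 \in [:: j; j.+1] & q3 \in [:: j; j.+1]] ->
    v1 q1 < u1 p1 -> u1 p2 <= v1 q2 -> v2 q2 < u2 p2 -> u2 p3 <= v2 q3 ->
    exists i j, [/\ (i <= n)%N, (j <= m)%N,
      `|u1 i - v1 j| <= 2 * eta & `|u2 i - v2 j| <= 2 * eta].
  move=> /and3P[hp1 hp2 hp3] /and3P[hq1 hq2 hq3] h1' h2' h3' h4'.
  have [? _ ? _] := near _ _ _ _ hp2 hp1 hq2 hq1.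
  have [_ ? _ ?] := near _ _ _ _ hp2 hp3 hq2 hq3.
  exists p2, q2; split.
  - by move: hp2; rewrite !inE => /orP[] /eqP -> //; exact: ltnW.
  - by move: hq2; rewrite !inE => /orP[] /eqP -> //; exact: ltnW.
  - exact: (change _ _ (u1 p1) (v1 q1)).
  - exact: (change' _ _ (u2 p3) (v2 q3)).
case: H => /andP[/or3P H1 /andP[/or3P H2 /or3P H3]];
  case: H2 => /andP[a1 a2]; case: H1 => b1; case: H3 => /andP[c1 c2];
  by apply: (rainbow_close _ _ _ _ _ _ _ _ b1 a1 a2 c2); rewrite !inE !eqxx ?orbT.
Qed.

End Crossing.

(** * Fine chains in connected sets, and separation of the plane *)

Section Chains.
Variable R : realType.
Implicit Types (p q a b k : plane R) (A S U : set (plane R)).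

Lemma open_ballP A :
  (forall p, A p -> exists2 r : R, 0 < r & forall q, `|q - p| < r -> A q) -> open A.
Proof.
move=> h; rewrite openE => p /h[r r0 hr].
by apply/nbhs_ballP; exists r => // q /ball_plane /hr.
Qed.

Lemma nbhs_plane p A : nbhs p A <-> exists2 r : R, 0 < r & forall q, `|q - p| < r -> A q.
Proof.
split=> [/nbhs_ballP[r r0 hr]|[r r0 hr]].
  by exists r => // q qp; apply: hr; apply/ball_plane.
by apply/nbhs_ballP; exists r => // q /ball_plane /hr.
Qed.

Definition segment a b : set (plane R) :=
  [set p | exists2 t : R, 0 <= t <= 1 & p = a + t *: (b - a)].

Lemma segment_start a b : segment a b a.
Proof. by exists 0; rewrite ?lexx ?ler01// scale0r addr0. Qed.

Lemma segment_end a b : segment a b b.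
Proof. by exists 1; rewrite ?lexx ?ler01// scale1r addrC subrK. Qed.

Lemma segment_is_connected a b : connected (segment a b).
Proof.
have -> : segment a b = (fun t : R => a + t *: (b - a)) @` `[0, 1]%classic.
  apply/seteqP; split=> [p [t t01 ->]|p [t t01 <-]].
    by exists t => //; rewrite /= in_itv.
  by exists t => //; move: t01; rewrite /= in_itv.
apply: connected_continuous_connected; first exact: segment_connected.
apply: continuous_subspaceT => t; apply: cvgD; first exact: cvg_cst.
by apply: cvgZr_tmp; exact: cvg_id.
Qed.

Lemma segment_ball p (r : R) a b : `|a - p| < r -> `|b - p| < r ->
  forall q, segment a b q -> `|q - p| < r.
Proof.
move=> ha hb q [t /andP[t0 t1] ->].
have -> : a + t *: (b - a) - p = (1 - t) *: (a - p) + t *: (b - p).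
  by apply: plane_eq; rewrite !coordE; ring.
apply: le_lt_trans (ler_normD _ _) _; rewrite !normrZ.
rewrite (ger0_norm t0) ger0_norm ?subr_ge0//.
have [->|t0'] := eqVneq t 0; first by rewrite subr0 mul1r mul0r addr0.
have tp : 0 < t by rewrite lt_def t0' t0.
have : t * `|b - p| < t * r by rewrite ltr_pM2l.
have : (1 - t) * `|a - p| <= (1 - t) * r.
  by apply: ler_wpM2l; [rewrite subr_ge0|exact: ltW].
lra.
Qed.

Lemma convex_connected A : (forall a b, A a -> A b -> segment a b `<=` A) ->
  connected A.
Proof.
move=> h; have [[a Aa]|A0] := pselect (A !=set0); last first.
  have -> : A = set0 by apply/seteqP; split=> // x Ax; case: A0; exists x.
  exact: connected0.
have -> : A = \bigcup_(b in A) segment a b.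
  apply/seteqP; split=> [b Ab|p [b Ab]]; first by exists b => //; exact: segment_end.
  exact: h.
apply: bigcup_connected; first by exists a => b _; exact: segment_start.
by move=> b _; exact: segment_is_connected.
Qed.

Definition chain (P : plane R -> Prop) (eta : R) a b : Prop :=
  exists n, exists c : nat -> plane R, [/\ c 0%N = a, c n = b,
    forall i, (i <= n)%N -> P (c i) & forall i, (i < n)%N -> `|c i.+1 - c i| <= eta].

Lemma chain_trans P eta a b d : chain P eta a b -> chain P eta b d -> chain P eta a d.
Proof.
move=> [n [c [c0 cn cP cs]]] [m [f [f0 fm fP fs]]].
exists (n + m)%N, (fun i => if (i <= n)%N then c i else f (i - n)%N); split=> //.
- by case: m f0 fm {fP fs} => [|m] f0 fm; rewrite ?addn0 ?leqnn ?cn -?f0 -?fm//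
    addnS ltnNge leq_addr/= subSn ?leq_addr// addKn.
- move=> i hi; case: leqP => h; first exact: cP.
  by apply: fP; lia.
move=> i hi; case: (ltngtP i n) => h.
- by apply: cs.
- have -> : (i.+1 - n = (i - n).+1)%N by lia.
  by apply: fs; lia.
by rewrite h subSn// subnn cn -f0; apply: fs; lia.
Qed.

Lemma chain_sub (P Q : plane R -> Prop) eta a b : (forall p, P p -> Q p) ->
  chain P eta a b -> chain Q eta a b.
Proof. by move=> h [n [c [c0 cn cP cs]]]; exists n, c; split=> // i /cP/h. Qed.

Lemma chain_segment (P : plane R -> Prop) eta a b : 0 < eta ->
  (forall p, segment a b p -> P p) -> chain P eta a b.
Proof.
move=> e0 h; pose n := (Num.truncn (`|b - a| / eta)).+1.
have n0 : 0 < n%:R :> R by rewrite ltr0n.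
exists n, (fun i => a + (i%:R / n%:R) *: (b - a)); split.
- by rewrite mul0r scale0r addr0.
- by rewrite divff ?gt_eqF// scale1r addrC subrK.
- move=> i hi; apply: h; exists (i%:R / n%:R) => //.
  by rewrite divr_ge0 ?ler0n//= ler_pdivrMr// mul1r ler_nat.
move=> i hi; have -> : a + (i.+1%:R / n%:R) *: (b - a) - (a + (i%:R / n%:R) *: (b - a))
    = n%:R^-1 *: (b - a).
  by rewrite opprD addrACA subrr add0r -scalerBl -mulrBl -natrB// subSnn mul1r.
rewrite normrZ gtr0_norm ?invr_gt0// [_ * `|_|]mulrC ler_pdivrMr// [eta * _]mulrC.
by rewrite -ler_pdivrMr//; apply: ltW; exact: Num.Theory.truncnS_gt.
Qed.

(** The margin [theta] and the level [M] are fixed before the mesh [eta]: a set of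
points reached with some margin and some level is open and closed in [U].
Increasing levels [O M] are allowed because fullness is needed for unions that
are exhausted by the basins of bounded time. *)
Lemma connected_chain (O : nat -> set (plane R)) U a b :
  (forall M M', (M <= M')%N -> O M `<=` O M') -> connected U ->
  (forall p, U p -> exists M, exists2 r : R, 0 < r & forall q, `|q - p| < r -> O M q) ->
  U a -> U b ->
  exists2 theta : R, 0 < theta & exists M, forall eta : R, 0 < eta ->
    chain (fun p => forall q, `|q - p| < theta -> O M q) eta a b.
Proof.
move=> mono Uc loc Ua Ub.
pose P : set (plane R) := [set b | exists2 theta : R, 0 < theta & exists M,
  forall eta : R, 0 < eta ->
    chain (fun p => forall q, `|q - p| < theta -> O M q) eta a b].
have step p M (r : R) x y : 0 < r -> (forall q, `|q - p| < r -> O M q) ->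
    `|x - p| < r / 2 -> `|y - p| < r / 2 -> P x -> P y.
  move=> r0 hM hx hy [th th0 [M' hc]].
  exists (Num.min th (r / 2)); first by rewrite lt_min th0 divr_gt0.
  exists (maxn M M') => eta e0; apply: (@chain_trans _ _ _ x).
    apply: chain_sub (hc _ e0) => p' hp' q; rewrite lt_min => /andP[/hp' + _].
    exact: mono (leq_maxr _ _) q.
  apply: chain_segment => // z /(segment_ball hx hy) zp q; rewrite lt_min => /andP[_ qz].
  apply: mono (leq_maxl _ _) _ _; apply: hM.
  rewrite -(subrK z q) -addrA; apply: le_lt_trans (ler_normD _ _) _.
  by rewrite [r]splitr ltrD.
pose nb (Q : set (plane R)) := [set x | exists p, exists2 r : R, 0 < r & exists M,
  [/\ U p, Q p, (forall q, `|q - p| < r -> O M q) & `|x - p| < r / 2]].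
have nbo Q : open (nb Q).
  apply: open_ballP => x [p [r r0 [M [Up Qp hM xp]]]].
  exists (r / 2 - `|x - p|); first by rewrite subr_gt0.
  move=> y yx; exists p, r => //; exists M; split=> //.
  rewrite -(subrK x y) -addrA; apply: le_lt_trans (ler_normD _ _) _; lra.
have Unb (Q : set (plane R)) x : U x -> Q x -> nb Q x.
  move=> Ux Qx; have [M [r r0 hM]] := loc _ Ux; exists x, r => //; exists M; split=> //.
  by rewrite subrr normr0 divr_gt0.
have r2 (r : R) p : 0 < r -> `|p - p| < r / 2 by move=> r0; rewrite subrr normr0 divr_gt0.
suff : U `&` P = U by move=> E; move: Ub; rewrite -E => -[].
apply: Uc.
- exists a; split=> //; have [M [r r0 hM]] := loc _ Ua.
  exists r => //; exists M => eta e0; apply: chain_segment => // p [t _ ->].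
  by rewrite subrr scaler0 addr0.
- exists (nb P) => //; apply/seteqP; split=> x [Ux Px]; split=> //.
    exact: Unb.
  by case: Px => p [r r0 [M [Up Pp hM xp]]]; apply: (step p M r p) => //; exact: r2.
- exists (~` nb (~` P)); first exact: open_closedC.
  apply/seteqP; split=> x [Ux Px]; split=> //.
    move=> [p [r r0 [M [Up Pp hM xp]]]]; apply: Pp.
    by apply: (step p M r x) => //; exact: r2.
  by apply: contrapT => Px'; apply: Px; apply: Unb.
Qed.

Lemma norm_dot k p : `|dot k p| <= (`|cx k| + `|cy k|) * `|p|.
Proof.
have [h1 h2] := (norm_leP p `|p|).1 (lexx _).
rewrite /dot; apply: le_trans (ler_normD _ _) _; rewrite !normrM mulrDl.
by apply: lerD; apply: ler_wpM2l.
Qed.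

Lemma norm_det k p : `|det k p| <= (`|cx k| + `|cy k|) * `|p|.
Proof.
have [h1 h2] := (norm_leP p `|p|).1 (lexx _).
rewrite /det; apply: le_trans (ler_normB _ _) _; rewrite !normrM mulrDl.
by apply: lerD; apply: ler_wpM2l.
Qed.

Lemma dotkk_gt0 k : k != 0 -> 0 < dot k k.
Proof.
move=> k0; rewrite lt_def addr_ge0 -?expr2 ?sqr_ge0// andbT /dot -!expr2.
rewrite paddr_eq0 ?sqr_ge0// !sqrf_eq0; apply: contraNN k0 => /andP[/eqP h1 /eqP h2].
by apply/eqP/plane_eq; rewrite coordE.
Qed.

Lemma detD k p q : det k (p + q) = det k p + det k q.
Proof. by rewrite /det !coordE; ring. Qed.
Lemma detN k p : det k (- p) = - det k p.
Proof. by rewrite /det !coordE; ring. Qed.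
Lemma detB k p q : det k (p - q) = det k p - det k q.
Proof. by rewrite detD detN. Qed.
Lemma detMn k p n : det k (p *+ n) = det k p *+ n.
Proof. by elim: n => [|n IH]; rewrite ?mulr0n ?mulrS -?IH /det ?coordE; ring. Qed.
Lemma dotD k p q : dot k (p + q) = dot k p + dot k q.
Proof. by rewrite /dot !coordE; ring. Qed.
Lemma dotN k p : dot k (- p) = - dot k p.
Proof. by rewrite /dot !coordE; ring. Qed.
Lemma dotB k p q : dot k (p - q) = dot k p - dot k q.
Proof. by rewrite dotD dotN. Qed.
Lemma dotMn k p n : dot k (p *+ n) = dot k p *+ n.
Proof. by elim: n => [|n IH]; rewrite ?mulr0n ?mulrS -?IH /dot ?coordE; ring. Qed.
Lemma detkk k : det k k = 0. Proof. by rewrite /det mulrC subrr. Qed.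

(** Along and across [k] the vector [p] is small, so [p] is small: the
normalisation by the length of [k] cancels. *)
Lemma small_of_dot_det k p (e : R) : k != 0 ->
  `|dot k p| <= (`|cx k| + `|cy k|) * e -> `|det k p| <= (`|cx k| + `|cy k|) * e ->
  `|p| <= 2 * e.
Proof.
move=> k0 h1 h2; set K := `|cx k| + `|cy k| in h1 h2.
have kk := dotkk_gt0 k0.
have K0 : 0 <= K by rewrite addr_ge0.
have Kk : K ^+ 2 <= 2 * dot k k.
  rewrite /K /dot; have := sqr_ge0 (`|cx k| - `|cy k|).
  have := real_normK (num_real (cx k)); have := real_normK (num_real (cy k)).
  rewrite sqrrB sqrrD !expr2; lra.
have e0 : 0 <= e.
  have Kp : 0 < K.
    rewrite lt_def K0 andbT paddr_eq0// !normr_eq0; apply: contraNN k0 => /andP[/eqP a /eqP b].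
    by apply/eqP/plane_eq; rewrite coordE.
  by have := le_trans (normr_ge0 _) h1; rewrite pmulr_rge0.
have key (x y z : R) : (dot k k) * x = y * dot k p + z * det k p ->
    `|y| + `|z| = K -> `|x| <= 2 * e.
  move=> E yz; rewrite -(ler_pM2l kk) -{1}(gtr0_norm kk) -normrM E.
  apply: le_trans (ler_normD _ _) _; rewrite !normrM.
  have : `|y| * `|dot k p| <= `|y| * (K * e) by apply: ler_wpM2l.
  have : `|z| * `|det k p| <= `|z| * (K * e) by apply: ler_wpM2l.
  have : K ^+ 2 * e <= 2 * dot k k * e by apply: ler_wpM2r.
  have : (`|y| + `|z|) * (K * e) = K ^+ 2 * e by rewrite yz; ring.
  lra.
apply/norm_leP; split.
  by apply: (key _ (cx k) (- cy k)); rewrite ?normrN// /dot /det; ring.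
by apply: (key _ (cy k) (cx k)); rewrite 1?[`|_| + _]addrC// /dot /det; ring.
Qed.

Lemma finite_bound (f : nat -> R) n : exists B : R, forall i, (i <= n)%N -> `|f i| <= B.
Proof.
elim: n => [|n [B hB]]; first by exists `|f 0%N| => i; rewrite leqn0 => /eqP ->.
exists (Num.max B `|f n.+1|) => i; rewrite leq_eqVlt => /orP[/eqP ->|].
  by rewrite le_max lexx orbT.
by rewrite ltnS => /hB h; rewrite le_max h.
Qed.

(** Repeating the chain periodically gives a discrete line in direction [k], which
crosses any chain going from far below to far above. At such a crossing a point
of [S] would be within the margin [theta], hence in [A]. *)
Lemma chain_sep A k a (theta : R) : k != 0 ->
  (forall p, A p -> A (p + k)) -> (forall p, A p -> A (p - k)) -> 0 < theta ->
  (forall eta : R, 0 < eta ->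
     chain (fun p => forall q, `|q - p| < theta -> A q) eta a (a + k)) ->
  exists c : R, forall S, connected S -> (forall p, S p -> ~ A p) ->
    forall b d, S b -> S d -> det k b < - c -> c < det k d -> False.
Proof.
move=> k0 Ap Am th0 hch.
have [|n [c [c0 cn cA cs]]] := hch (theta / 16); first by rewrite divr_gt0.
have n0 : (0 < n)%N.
  rewrite lt0n; apply: contraNneq k0 => nE; move: cn; rewrite nE c0 => /eqP.
  by rewrite -subr_eq0 opprD addrA subrr sub0r oppr_eq0.
have [B hB] := finite_bound (fun i => det k (c i)) n.
exists B => S Sc SA b d Sb Sd hb hd.
have [||th' th'0 [M hch']] := @connected_chain
    (fun _ => [set q | exists2 s, S s & `|q - s| < theta / 4]) S b d _ Sc _ Sb Sd.
  by move=> M M' _ q.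
  by move=> p Sp; exists 0%N, (theta / 4); [rewrite divr_gt0|move=> q qp; exists p].
have [|m [f [f0 fm fS fs]]] := hch' (theta / 16); first by rewrite divr_gt0.
have [D hD] := finite_bound (fun j => dot k (f j)) m.
have kk := dotkk_gt0 k0.
(* enough periods to leave the extent of the second chain on both sides *)
pose J := (Num.truncn ((D + `|dot k a|) / dot k k)).+1.
have hJ : D + `|dot k a| < J%:R * dot k k.
  by rewrite -ltr_pdivrMr// /J; exact: Num.Theory.truncnS_gt.
pose g i := c (i %% n)%N + k *+ (i %/ n)%N - k *+ J.
have gs i : `|g i.+1 - g i| <= theta / 16.
  have hmod : (i %% n < n)%N by rewrite ltn_mod.
  have -> : g i.+1 - g i = c (i %% n).+1 - c (i %% n)%N.
    rewrite /g modnS divnS//; case: (boolP (n %| i.+1)%N) => h.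
      have -> : (i %% n).+1 = n.
        by move: h; rewrite /dvdn -addn1 -modnDml addn1 => /eqP h;
           apply/eqP; rewrite eqn_leq hmod /= leqNgt; apply/negP => h';
           move: h; rewrite modn_small.
      by rewrite cn c0 add1n mulrS; apply: plane_eq; rewrite !coordE; ring.
    by rewrite add0n; apply: plane_eq; rewrite !coordE; ring.
  exact: cs.
pose K := `|cx k| + `|cy k|.
have K0 : 0 <= K by rewrite addr_ge0.
have stepK (x y : plane R) : `|x - y| <= theta / 16 ->
    `|dot k x - dot k y| <= K * (theta / 16) /\ `|det k x - det k y| <= K * (theta / 16).
  move=> h; rewrite -dotB -detB; split.
    by apply: le_trans (norm_dot _ _) _; apply: ler_wpM2l.
  by apply: le_trans (norm_det _ _) _; apply: ler_wpM2l.
have detg i : det k (g i) = det k (c (i %% n)%N).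
  by rewrite /g detB detD !detMn detkk !mul0rn addr0 subr0.
have dotg i : dot k (g i) = dot k (c (i %% n)%N) + dot k k * ((i %/ n)%:R - J%:R).
  by rewrite /g dotB dotD !dotMn -(mulr_natr _ (i %/ n)) -(mulr_natr _ J); ring.
have modle i : (i %% n <= n)%N by rewrite ltnW// ltn_mod.
have ha := ler_norm (dot k a); have ha' := ler_norm (- dot k a).
rewrite normrN in ha'.
have [|||i|i [j [hi hj h1 h2]]] := @discrete_crossing R (J * 2 * n) m
    (fun i => dot k (g i)) (fun i => det k (g i))
    (fun j => dot k (f j)) (fun j => det k (f j)) (K * (theta / 16)).
- by move=> i _; apply: stepK.
- by move=> j hj; apply: stepK; apply: fs.
- move=> j hj; rewrite !dotg mod0n div0n modnMl mulnK// c0 natrM.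
  have := hD _ hj; rewrite ler_norml => /andP[]; lra.
- move=> hi; rewrite detg f0 fm; have := hB _ (modle i); rewrite ler_norml => /andP[]; lra.
move: h1 h2; rewrite -dotB -detB => h1 h2.
have close : `|g i - f j| <= 2 * (2 * (theta / 16)).
  apply: (small_of_dot_det k0); rewrite -/K mulrCA.
    exact: h1.
  exact: h2.
have [|s Ss fsj] := fS _ hj (f j); first by rewrite subrr normr0.
apply: (SA s Ss).
have shift q : A (q + k *+ J - k *+ (i %/ n)%N) -> A q.
  have Apn x N : A x -> A (x + k *+ N).
    by move=> Ax; elim: N => [|N IH]; rewrite ?mulr0n ?addr0// mulrSr addrA; apply: Ap.
  have Amn x N : A x -> A (x - k *+ N).
    by move=> Ax; elim: N => [|N IH]; rewrite ?mulr0n ?subr0// mulrSr opprD addrA; apply: Am.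
  move=> /Apn-/(_ (i %/ n)%N) /Amn-/(_ J); rewrite subrK addrK; exact.
apply: shift; apply: (cA _ (modle i)).
have -> : s + k *+ J - k *+ (i %/ n)%N - c (i %% n)%N = (f j - g i) - (f j - s).
  by rewrite /g; apply: plane_eq; rewrite !coordE; ring.
by apply: le_lt_trans (ler_normB _ _) _; rewrite [`|f j - g i|]distrC; lra.
Qed.

End Chains.

(** * Full sets *)

Section Full.
Variable R : realType.
Implicit Types (p q a b k l : plane R) (A B S U : set (plane R)).

Definition lat_invariant A := forall p l, lat l -> A p -> A (p + l).

(** Both translates [a + k] and [a + k'] belong to the same connected set as [a], so
that the integer translates of [U] form a connected net in two directions. *)
Definition full A := exists k k' a U,
  [/\ lat k /\ lat k', det k k' != 0, connected U, U `<=` A &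
      [/\ U a, U (a + k) & U (a + k')]].

Lemma plane_continuousP (f : plane R -> plane R) : continuous f <->
  forall p (e : R), 0 < e -> exists2 r : R, 0 < r &
    forall q, `|q - p| < r -> `|f q - f p| < e.
Proof.
split=> [fc p e e0|h p A /nbhs_plane[e e0 hA]].
  have : nbhs (f p) [set q | `|q - f p| < e] by apply/nbhs_plane; exists e.
  by move=> /fc/nbhs_plane.
have [r r0 hr] := h p e e0; apply/nbhs_plane; exists r => // q /hr; exact: hA.
Qed.

Definition translate l S : set (plane R) := [set p + l | p in S].

Lemma connected_translate l S : connected S -> connected (translate l S).
Proof.
move=> Sc; apply: connected_continuous_connected => //.
apply: continuous_subspaceT; apply/plane_continuousP => p e e0.
by exists e => // q; rewrite opprD addrACA subrr addr0.
Qed.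

Lemma lat_Mz l (z : int) : lat l -> lat (l *~ z).
Proof. by move=> ll; rewrite /lat rpredMz. Qed.

Lemma detMz k l (z : int) : det k (l *~ z) = det k l *~ z.
Proof.
case: z => n; first by rewrite -!pmulrn detMn.
by rewrite !NegzE !mulrNz -!pmulrn detN detMn.
Qed.

(** The separating line of [chain_sep] can be translated by multiples of [k'], so
every connected set that avoids [A] is caught between two copies at a bounded
distance. *)
Lemma strip_width A a k k' (theta : R) : lat_invariant A -> lat k -> lat k' ->
  det k k' != 0 -> 0 < theta ->
  (forall eta : R, 0 < eta ->
     chain (fun p => forall q, `|q - p| < theta -> A q) eta a (a + k)) ->
  exists W : R, forall S, connected S -> (forall p, S p -> ~ A p) ->
    forall b d, S b -> S d -> `|det k b - det k d| <= W.
Proof.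
move=> Aper lk lk' kk' th0 hch.
have k0 : k != 0.
  by apply: contraNneq kk' => ->; rewrite /det !coordE !mul0r subrr.
have [||c hc] := chain_sep k0 _ _ th0 hch.
- by move=> p; apply: Aper.
- by move=> p; apply: Aper; exact: latN.
pose dl := `|det k k'|; have dl0 : 0 < dl by rewrite normr_gt0.
have [l ll detl] : exists2 l, lat l & det k l = dl.
  rewrite /dl; case: (ger0P (det k k')) => _; first by exists k'.
  by exists (- k'); [exact: latN|rewrite detN].
exists (2 * `|c| + 2 * dl) => S Sc SA.
have key b d : S b -> S d -> det k d - det k b <= 2 * `|c| + 2 * dl.
  move=> Sb Sd; rewrite leNgt; apply/negP => hw.
  pose j : int := - Num.floor ((det k b + c) / dl) - 1.
  pose v := l *~ j; have lv : lat v by exact: lat_Mz.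
  have detv : det k v = dl * j%:~R by rewrite detMz detl mulrzr.
  have fl : (Num.floor ((det k b + c) / dl))%:~R <= (det k b + c) / dl
         < (Num.floor ((det k b + c) / dl))%:~R + 1.
    by have := Num.Theory.floor_itv ((det k b + c) / dl); rewrite intrD1.
  have j1 : det k b + dl * j%:~R < - c.
    have /andP[_ h] := fl; move: h; rewrite ltr_pdivrMr// /j rmorphB rmorphN /=; lra.
  have j2 : - c - dl <= det k b + dl * j%:~R.
    have /andP[h _] := fl; move: h; rewrite ler_pdivlMr// /j rmorphB rmorphN /=; lra.
  have := ler_norm c; have := ler_norm (- c); rewrite normrN => cc1 cc2.
  apply: (hc (translate v S) _ _ (b + v) (d + v)).
  - exact: connected_translate.
  - move=> _ [p Sp <-] /(Aper _ _ (latN lv)); rewrite addrK; exact: SA.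
  - by exists b.
  - by exists d.
  - by rewrite detD detv.
  - rewrite detD detv; lra.
move=> b d Sb Sd; rewrite ler_norml; have := key _ _ Sb Sd; have := key _ _ Sd Sb; lra.
Qed.

(** The set [S] has bounded width across [k] and across [k'], which are
independent. One level of the exhaustion suffices because two chains are finite. *)
Lemma full_bounded (O : nat -> set (plane R)) :
  (forall M M', (M <= M')%N -> O M `<=` O M') ->
  (forall M, lat_invariant (O M)) ->
  (forall M p, O M p -> exists M', exists2 r : R, 0 < r & forall q, `|q - p| < r -> O M' q) ->
  full (\bigcup_M O M) ->
  exists M C, forall S, connected S -> (forall p, S p -> ~ O M p) ->
    forall b d, S b -> S d -> `|b - d| <= C :> R.
Proof.
move=> mono per loc [k [k' [a [U [[lk lk'] kk' Uc UO [Ua Uak Uak']]]]]].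
have locU p : U p -> exists M, exists2 r : R, 0 < r & forall q, `|q - p| < r -> O M q.
  by move=> /UO[M _ /loc].
have [th th0 [M hM]] := connected_chain mono Uc locU Ua Uak.
have [th' th'0 [M' hM']] := connected_chain mono Uc locU Ua Uak'.
have kk'' : det k' k != 0.
  by rewrite (_ : det k' k = - det k k') ?oppr_eq0// /det; ring.
have [|W hW] := strip_width (per (maxn M M')) lk lk' kk' th0 _ (a := a).
  move=> eta /hM; apply: chain_sub => p h q /h; exact: mono (leq_maxl _ _) q.
have [|W' hW'] := strip_width (per (maxn M M')) lk' lk kk'' th'0 _ (a := a).
  move=> eta /hM'; apply: chain_sub => p h q /h; exact: mono (leq_maxr _ _) q.
have dp : 0 < `|det k k'| by rewrite normr_gt0.
exists (maxn M M'), ((`|k'| * W + `|k| * W') / `|det k k'|) => S Sc SO b d Sb Sd.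
have := hW _ Sc SO _ _ Sb Sd; have := hW' _ Sc SO _ _ Sb Sd; rewrite -!detB.
set p := b - d => h' h.
have [kx ky] := (norm_leP k `|k|).1 (lexx _).
have [kx' ky'] := (norm_leP k' `|k'|).1 (lexx _).
have key (x y z : R) : x * det k k' = y * det k p - z * det k' p ->
    `|y| <= `|k'| -> `|z| <= `|k| -> `|x| <= (`|k'| * W + `|k| * W') / `|det k k'|.
  move=> E hy hz; rewrite ler_pdivlMr// -normrM E.
  apply: le_trans (ler_normB _ _) _; rewrite !normrM.
  by apply: lerD; apply: ler_pM.
apply/norm_leP; split.
  by apply: (key _ (cx k') (cx k)) => //; rewrite /det; ring.
by apply: (key _ (cy k') (cy k)) => //; rewrite /det; ring.
Qed.

(** Translates of the connected set along [k] overlap at the points [a + n k]. *)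
Lemma periodic_line A : lat_invariant A -> full A ->
  forall C : R, exists S, exists b d, [/\ connected S, S `<=` A, S b, S d & C < `|b - d|].
Proof.
move=> Aper [k [k' [a [U [[lk lk'] kk' Uc UO [Ua Uak Uak']]]]]] C.
have k0 : k != 0.
  by apply: contraNneq kk' => ->; rewrite /det !coordE !mul0r subrr.
have Sn n : exists S, [/\ connected S, S `<=` A, S a & S (a + k *+ n)].
  elim: n => [|n [S [Sc SA Sa San]]]; first by exists U; rewrite mulr0n addr0.
  exists (S `|` translate (k *+ n) U); split.
  - apply: connectedU => //; last exact: connected_translate.
    by exists (a + k *+ n); split=> //; exists a.
  - by move=> p [/SA//|[q Uq <-]]; apply: Aper; [exact: latMn|exact: UO].
  - by left.
  - by right; exists (a + k) => //; rewrite mulrS addrA.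
have kp : 0 < `|k| by rewrite normr_gt0.
pose n := (Num.truncn (C / `|k|)).+1.
have [S [Sc SA Sa San]] := Sn n.
exists S, (a + k *+ n), a; split=> //.
rewrite addrAC subrr add0r normrMn -mulr_natr mulrC -ltr_pdivrMr//.
exact: Num.Theory.truncnS_gt.
Qed.

(** Otherwise the unbounded line of [periodic_line] in [B] would be a connected set
avoiding [A], which [full_bounded] forbids. *)
Lemma full_meet A B : open A -> lat_invariant A -> lat_invariant B -> full A -> full B ->
  A `&` B !=set0.
Proof.
move=> Ao Aper Bper Af Bf.
have [|||M [C hC]] := @full_bounded (fun _ => A) _ (fun _ => Aper).
- by move=> M M1 _ p.
- move=> _ p Ap; exists 0%N; apply/nbhs_plane; exact: open_nbhs_nbhs.
- rewrite (_ : \bigcup__ A = A)//; apply/seteqP; split=> [p []//|p Ap].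
  by exists 0%N.
have [S [b [d [Sc SB Sb Sd hbd]]]] := periodic_line Bper Bf C.
apply: contrapT => AB0; move: hbd; apply/negP; rewrite -leNgt.
apply: hC Sb Sd => // p Sp Ap; apply: AB0; exists p; split=> //; exact: SB.
Qed.

Lemma full_sub A B : A `<=` B -> full A -> full B.
Proof.
move=> AB [k [k' [a [U [h1 h2 h3 h4 h5]]]]]; exists k, k', a, U; split=> //.
exact: subset_trans AB.
Qed.

Lemma fullT : full setT.
Proof.
exists (vec 1 0), (vec 0 1), 0, setT; split=> //.
- by split; apply/latP; rewrite !coordE ?rpred0 ?rpred1.
- by rewrite /det !coordE mulr1 mulr0 subr0 oner_eq0.
- exact: convex_connected.
Qed.

Lemma full_image (h : plane R -> plane R) A : continuous h ->
  (forall p l, lat l -> h (p + l) = h p + l) -> full A -> full (h @` A).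
Proof.
move=> hc hper [k [k' [a [U [[lk lk'] kk' Uc UO [Ua Uak Uak']]]]]].
exists k, k', (h a), (h @` U); split=> //.
- by apply: connected_continuous_connected => //; exact: continuous_subspaceT.
- exact: image_subset.
- by rewrite -!hper//; split; apply: imageP.
Qed.

End Full.

(** * Lifts of torus homeomorphisms, and noise *)

Section Lifts.
Variable R : realType.
Implicit Types (p q x y z : plane R).

Definition unit_square : set (plane R) :=
  [set p | 0 <= cx p <= 1 /\ 0 <= cy p <= 1].

Lemma unit_square_compact : compact unit_square.
Proof.
have -> : unit_square = [set v : 'rV[R]_2 | forall i, `[0, 1]%classic (v ord0 i)].
  apply/seteqP; split=> [p [hx hy] i|p h].
    by case: (ord2P i) => ->; rewrite /= in_itv.
  by split; [have := h 0|have := h 1]; rewrite /= in_itv.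
apply: (@rV_compact R 2 (fun=> `[0, 1]%classic)) => i; exact: segment_compact.
Qed.

Lemma lat_floor p : exists2 l, lat l & unit_square (p - l).
Proof.
exists (vec (Num.floor (cx p))%:~R (Num.floor (cy p))%:~R).
  by apply/latP; rewrite !coordE !intr_int.
have := Num.Theory.floor_itv (cx p); have := Num.Theory.floor_itv (cy p).
by rewrite /unit_square/= !coordE !intrD1 => /andP[? ?] /andP[? ?]; split; lra.
Qed.

(** Compactness in the form used below: a radius that exists locally can be chosen
uniformly on a fundamental domain. *)
Lemma unit_square_uniform (P : R -> plane R -> Prop) :
  (forall d d' p, d' <= d -> P d p -> P d' p) ->
  (forall x, exists2 r, 0 < r & forall y, `|y - x| < r -> P r y) ->
  exists2 d, 0 < d & forall x, unit_square x -> P d x.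
Proof.
move=> mono loc.
have /compact_near_coveringP h := unit_square_compact.
have H : forall x, unit_square x ->
    \forall y \near x & d \near (0 : R)^'+, P d y.
  move=> x _; have [r r0 hr] := loc x.
  exists ([set y | `|y - x| < r], [set d : R | 0 < d < r]).
    split; first by apply/nbhs_plane; exists r.
    near=> d; apply/andP; split; near: d; [exact: nbhs_right_gt|exact: nbhs_right_lt].
  by move=> [y d] /= [yx /andP[d0 dr]]; apply: mono (ltW dr) _; exact: hr.
have near0 := h _ _ _ _ H.
have : \forall d \near (0:R)^'+, 0 < d /\ unit_square `<=` P d.
  by near=> d; split; near: d; [exact: nbhs_right_gt|exact: near0].
by move=> /filter_ex[d [d0 hd]]; exists d.
Unshelve. all: by end_near. Qed.

Record lift_homeo (g h : plane R -> plane R) : Prop := LiftHomeo {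
  lift_cont : continuous g;
  lift_inv_cont : continuous h;
  lift_per : forall p l, lat l -> g (p + l) = g p + l;
  lift_gK : cancel g h;
  lift_hK : cancel h g }.

Lemma lift_inv_per g h : lift_homeo g h -> forall p l, lat l -> h (p + l) = h p + l.
Proof. by case=> _ _ per gK hK p l ll; rewrite -{1}(hK p) -per// gK. Qed.

Lemma lift_homeo_sym g h : lift_homeo g h -> lift_homeo h g.
Proof. by move=> gh; have := lift_inv_per gh; case: gh => *; split. Qed.

Lemma lift_uniform g h : lift_homeo g h -> forall e : R, 0 < e ->
  exists2 d : R, 0 < d & forall p q, `|q - p| < d -> `|g q - g p| < e.
Proof.
move=> gh e e0.
have [||d d0 hd] := @unit_square_uniform
   (fun d p => forall q, `|q - p| < d -> `|g q - g p| < e).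
- by move=> d d' p dd' hp q qp; apply: hp; exact: lt_le_trans dd'.
- move=> x; have e2 : 0 < e / 2 by rewrite divr_gt0.
  have [r r0 hr] := (plane_continuousP g).1 (lift_cont gh) x _ e2.
  exists (r / 2) => [|y yx q qy]; first by rewrite divr_gt0.
  have -> : g q - g y = (g q - g x) - (g y - g x).
    by rewrite opprB addrA subrK.
  apply: le_lt_trans (ler_normB _ _) _; rewrite [e]splitr; apply: ltrD; apply: hr.
    by rewrite -(subrK y q) -addrA; apply: le_lt_trans (ler_normD _ _) _; lra.
  lra.
exists d => // p q qp; have [l ll hl] := lat_floor p.
have -> : g q - g p = g (q - l) - g (p - l).
  by rewrite -{1}(subrK l q) -{1}(subrK l p) (lift_per gh _ ll) (lift_per gh _ ll) opprD addrACA subrr addr0.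
by apply: hd => //; rewrite opprB addrA subrK.
Qed.

Lemma lift_displacement g h : lift_homeo g h ->
  exists2 B : R, 0 < B & forall p, `|g p - p| <= B.
Proof.
move=> gh.
have [||d d0 hd] := @unit_square_uniform (fun d p => 0 < d -> `|g p - p| <= d^-1).
- move=> d d' p dd' hp d'0; have d0 := lt_le_trans d'0 dd'.
  by apply: le_trans (hp d0) _; rewrite lef_pV2.
- move=> x; have [r r0 hr] := (plane_continuousP g).1 (lift_cont gh) x _ ltr01.
  pose c := `|g x - x| + 2; have c0 : 0 < c by rewrite ltr_wpDl.
  exists (Num.min (Num.min r 1) c^-1); first by rewrite !lt_min r0 ltr01 invr_gt0.
  move=> y; rewrite !lt_min => /andP[/andP[yr y1] yc] _.
  apply: (@le_trans _ _ c); last first.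
    by rewrite -[leLHS]invrK lef_pV2 ?ge_min ?lexx ?orbT// posrE ?lt_min ?r0 ?ltr01 invr_gt0.
  have -> : g y - y = (g y - g x) + (g x - x) - (y - x).
    by apply: plane_eq; rewrite !coordE; ring.
  apply: le_trans (ler_normB _ _) _; apply: le_trans (lerD (ler_normD _ _) (lexx _)) _.
  by have := hr _ yr; rewrite /c; lra.
exists d^-1 => [|p]; first by rewrite invr_gt0.
have [l ll hl] := lat_floor p; have := hd _ hl d0.
have -> : g p - p = g (p - l) - (p - l).
  by rewrite -{1 2}(subrK l p) (lift_per gh _ ll) opprD addrACA subrr addr0.
by [].
Qed.

Record noise_set (E : set (plane R)) : Prop := NoiseSet {
  noise_open : open E;
  noise0 : E 0;
  noiseN : forall v, E v -> E (- v);
  noise_convex : forall a b, E a -> E b -> segment a b `<=` E;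
  noise_bounded : exists B : R, forall v, E v -> `|v| <= B }.

Lemma noise_near E v : noise_set E -> E v ->
  exists2 r : R, 0 < r & forall w, `|w - v| < r -> E w.
Proof. by move=> hE Ev; apply/nbhs_plane; apply: open_nbhs_nbhs; split=> //; exact: noise_open. Qed.

End Lifts.

(** * Pseudo-orbits, and redirecting their end to a hub *)

Section Reach.
Variable R : realType.
Implicit Types (p q x y z k l e : plane R) (g h : plane R -> plane R) (E S : set (plane R)).

(** Pseudo-orbits are recorded by their end points and length only. *)
Fixpoint reach g E n x y : Prop :=
  if n is m.+1 then exists2 z, reach g E m x z & E (y - g z) else y = x.

Lemma reach1 g E x y : reach g E 1 x y <-> E (y - g x).
Proof. by split=> [[z ->]//|h]; exists x. Qed.

Lemma reach_add g E n m x y z :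
  reach g E n x y -> reach g E m y z -> reach g E (n + m) x z.
Proof.
elim: m z => [|m IH] z hx; first by move=> ->; rewrite addn0.
by move=> [w hw Ew]; rewrite addnS; exists w => //; exact: IH.
Qed.

Lemma reach_split g E n m x z :
  reach g E (n + m) x z -> exists2 y, reach g E n x y & reach g E m y z.
Proof.
elim: m z => [|m IH] z; first by rewrite addn0 => hx; exists z.
by rewrite addnS => -[w /IH[y hy hw] Ew]; exists y => //; exists w.
Qed.

Lemma reach_cons g E n x y z : E (y - g x) -> reach g E n y z -> reach g E n.+1 x z.
Proof. by move=> h hz; rewrite -add1n; apply: reach_add hz; apply/reach1. Qed.

Lemma reach_head g E n x z :
  reach g E n.+1 x z -> exists2 y, E (y - g x) & reach g E n y z.
Proof. by rewrite -add1n => /reach_split[y /reach1 ? ?]; exists y. Qed.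

Lemma reach_lat g h E n x y l : lift_homeo g h -> lat l ->
  reach g E n x y -> reach g E n (x + l) (y + l).
Proof.
move=> gh ll; elim: n y => [|n IH] y; first by move=> /= ->.
move=> [z hz Ez]; exists (z + l); first exact: IH.
by rewrite (lift_per gh)// opprD addrACA subrr addr0.
Qed.

(** Reversing a pseudo-orbit of [g] gives a pseudo-orbit of the inverse only after
applying [g] to its points: the noise is added after the map. *)
Lemma reach_inv g h E n x y : lift_homeo g h -> noise_set E ->
  reach g E n x y -> reach h E n (g y) (g x).
Proof.
move=> gh hE; elim: n y => [|n IH] y; first by move=> /= ->.
move=> [z /IH hz Ez]; apply: reach_cons hz.
by rewrite (lift_gK gh) -opprB; exact: noiseN.
Qed.

Lemma reach_displacement g h E : lift_homeo g h -> noise_set E ->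
  exists2 B : R, 0 < B & forall n x y, reach g E n x y -> `|y - x| <= n%:R * B.
Proof.
move=> gh hE; have [B B0 hB] := lift_displacement gh.
have [D hD] := noise_bounded hE.
have D0 : 0 <= D by rewrite (le_trans _ (hD _ (noise0 hE))).
exists (B + D); first by rewrite ltr_wpDr.
move=> n x; elim: n => [|n IH] y; first by move=> /= ->; rewrite subrr normr0 mul0r.
move=> [z /IH hz /hD Ez].
have -> : y - x = (y - g z) + (g z - z) + (z - x).
  by apply: plane_eq; rewrite !coordE; ring.
apply: le_trans (ler_normD _ _) _; apply: le_trans (lerD (ler_normD _ _) (lexx _)) _.
by have := hB z; rewrite -[n.+1]addn1 natrD; lra.
Qed.

Lemma reach_orbit g h E n x : lift_homeo g h -> noise_set E -> reach g E n x (iter n g x).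
Proof.
move=> gh hE; elim: n => [//|n IH]; exists (iter n g x) => //=.
by rewrite subrr; exact: noise0.
Qed.

(** The images [g z + E] are connected and attached to the connected image of [S]. *)
Lemma connected_reach g h E n S : lift_homeo g h -> noise_set E -> connected S ->
  connected [set y | exists2 x, S x & reach g E n x y].
Proof.
move=> gh hE Sc; elim: n => [|n IH].
  by rewrite (_ : [set y | _] = S)//; apply/seteqP; split=> [y [x Sx ->]//|y Sy]; exists y.
set T := [set y | exists2 x, S x & reach g E n x y] in IH.
have [T0|T0] := pselect (T !=set0); last first.
  rewrite (_ : [set y | _] = set0); first exact: connected0.
  apply/seteqP; split=> // y [x Sx [z hz _]]; apply: T0; exists z; exists x => //.
have Ec : connected E by apply: convex_connected => a b; exact: noise_convex.
have -> : [set y | exists2 x, S x & reach g E n.+1 x y] =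
    \bigcup_(z in T) (g @` T `|` translate (g z) E).
  apply/seteqP; split=> [y [x Sx [z hz Ez]]|y [z [x Sx hz] [[w [x' Sx' hw] <-]|[v Ev <-]]]].
  - exists z; first by exists x.
    by right; exists (y - g z) => //; rewrite subrK.
  - exists x' => //; exists w => //; rewrite subrr; exact: noise0.
  - by exists x => //; exists z => //; rewrite addrK.
apply: bigcup_connected.
  by have [w Tw] := T0; exists (g w) => z Tz; left; exists w.
move=> z Tz; apply: connectedU.
- exists (g z); split; first by exists z.
  by exists 0; [exact: noise0|rewrite add0r].
- apply: connected_continuous_connected => //; apply: continuous_subspaceT.
  exact: lift_cont gh.
- exact: connected_translate.
Qed.

Definition basin g E e M : set (plane R) :=
  [set x | exists j k, [/\ (j <= M)%N, lat k & reach g E j x (e + k)]].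

Lemma basin_mono g E e M M' : (M <= M')%N -> basin g E e M `<=` basin g E e M'.
Proof. by move=> h x [j [k [hj lk hr]]]; exists j, k; split=> //; exact: leq_trans h. Qed.

Lemma basin_invariant g h E e M : lift_homeo g h -> lat_invariant (basin g E e M).
Proof.
move=> gh x l ll [j [k [hj lk hr]]]; exists j, (k + l); split=> //; first exact: latD.
by rewrite addrA; apply: (reach_lat gh).
Qed.

(** A basin is not open, since [e] itself reaches [e] in zero steps, but it has a
uniform neighbourhood contained in a slightly later basin. A perturbation of the
starting point is absorbed by moving the next point of the pseudo-orbit, except
at [e], where the loop is run once. *)
Lemma basin_near g h E e m k : lift_homeo g h -> noise_set E ->
  lat k -> reach g E m.+1 e (e + k) ->
  forall M, exists2 eta : R, 0 < eta &
    forall p q, basin g E e M p -> `|q - p| < eta -> basin g E e (M + m.+1) q.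
Proof.
move=> gh hE lk loop; elim=> [|M [eta eta0 IH]].
  have [y Ey hy] := reach_head loop.
  have [r r0 hr] := noise_near hE Ey.
  have [d d0 hd] := lift_uniform gh r0.
  exists d => // p q [j [l [+ ll hp]]]; rewrite leqn0 => /eqP j0 qp.
  move: hp; rewrite j0 /= => hp; exists m.+1, (k + l); split=> //; first exact: latD.
  rewrite addrA; apply: (@reach_cons _ _ _ _ (y + l)); last exact: reach_lat gh ll hy.
  apply: hr; have -> : y + l - g q - (y - g e) = - (g q - g p).
    by rewrite -hp (lift_per gh)//; apply: plane_eq; rewrite !coordE; ring.
  by rewrite normrN; exact: hd.
have [d d0 hd] := lift_uniform gh eta0.
exists (Num.min d eta); first by rewrite lt_min d0.
move=> p q [[|j] [l [hj ll hp]]]; rewrite lt_min => /andP[qd qe].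
  have : basin g E e (M + m.+1) q.
    by apply: IH qe; exists 0%N, l.
  by apply: basin_mono; exact: leqnSn.
have [y Ey hy] := reach_head hp.
(* the same noise as from p to y, now applied at q *)
pose y' := y + (g q - g p).
have [||i [k' [hi lk' hq]]] := IH y y'.
- by exists j, l.
- by rewrite /y' addrAC subrr add0r; apply: hd.
exists i.+1, k'; split=> //.
apply: reach_cons hq; rewrite /y'.
by have -> : y + (g q - g p) - g q = y - g p by apply: plane_eq; rewrite !coordE; ring.
Qed.

(** The point [z] is chosen just before the infimum of the times spent in [A]. *)
Lemma first_entry (A : set (plane R)) x w (eta : R) : 0 < eta -> ~ A x -> A w ->
  exists z, [/\ segment x w z, (forall p, segment x z p -> ~ A p) &
     exists2 p, A p & `|z - p| < eta].
Proof.
move=> e0 nAx Aw.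
pose I := [set t : R | 0 <= t <= 1 /\ A (x + t *: (w - x))].
have I1 : I 1 by split; rewrite ?ler01 ?lexx// scale1r addrC subrK.
have Ilb : has_inf I by split; [exists 1|exists 0 => t [/andP[]]].
pose D := eta / (2 * (`|w - x| + 1)).
have n0 : 0 < 2 * (`|w - x| + 1) by rewrite mulr_gt0// ltr_wpDl.
have D0 : 0 < D by rewrite divr_gt0.
have [t0 [/andP[t00 t01] At0] ht0] := inf_adherent D0 Ilb.
have tinf t : I t -> inf I <= t by move=> It; apply: ge_inf => //; have [] := Ilb.
have inf0 : 0 <= inf I by apply: lb_le_inf; [exists 1|move=> t [/andP[]]].
have inft0 := tinf _ (conj (introT andP (conj t00 t01)) At0).
pose t1 := Num.max 0 (inf I - D).
have t1ge : 0 <= t1 by rewrite /t1 le_max lexx.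
have t1le : t1 <= inf I by rewrite /t1 ge_max inf0 gerBl ltW.
have t1D : inf I - D <= t1 by rewrite /t1 le_max lexx orbT.
exists (x + t1 *: (w - x)); split.
- by exists t1 => //; rewrite t1ge; lra.
- move=> p [s /andP[s0 s1] ->].
  have -> : x + s *: (x + t1 *: (w - x) - x) = x + (s * t1) *: (w - x).
    by apply: plane_eq; rewrite !coordE; ring.
  move=> Ap.
  have st0 : 0 <= s * t1 by rewrite mulr_ge0.
  have st1 : s * t1 <= t1 by rewrite ler_piMl.
  have st2 : s * t1 <= 1 by lra.
  have := tinf _ (conj (introT andP (conj st0 st2)) Ap).
  move: (t1ge) st1 Ap; rewrite /t1; case: (ltP 0 (inf I - D)) => [h|h] _ st1 Ap hinf.
    lra.
  by move: Ap; rewrite mulr0 scale0r addr0.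
exists (x + t0 *: (w - x)) => //.
have -> : x + t1 *: (w - x) - (x + t0 *: (w - x)) = (t1 - t0) *: (w - x).
  by apply: plane_eq; rewrite !coordE; ring.
rewrite normrZ.
have h1 : `|t1 - t0| <= 2 * D by rewrite ler_norml; apply/andP; split; lra.
apply: (@le_lt_trans _ _ (2 * D * `|w - x|)); first exact: ler_wpM2r.
have -> : eta = 2 * D * (`|w - x| + 1).
  by rewrite /D; field; rewrite gt_eqF// ltr_wpDl.
by rewrite ltr_pM2l ?mulr_gt0// ltrDl.
Qed.

Section Forward.
Variables (g h : plane R -> plane R) (E : set (plane R)) (e k0 : plane R) (m M0 : nat) (C : R).
Hypotheses (gh : lift_homeo g h) (hE : noise_set E).
Hypotheses (lk0 : lat k0) (loop : reach g E m.+1 e (e + k0)).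
Hypothesis confined : forall S, connected S -> (forall p, S p -> ~ basin g E e M0 p) ->
  forall b d, S b -> S d -> `|b - d| <= C.

Let M1 := (M0 + m)%N.

(** The segment from [x] to [z] avoids the basin of level [n + M1], so its futures
after [n] steps avoid the basin of level [M1] and form a connected set, which is
bounded by [confined]. Hence [y] is close to the point that the pseudo-orbit
from [z] to [e] visits at time [n], and little time remains after that. *)
Lemma shadowing : exists C' : R, 0 <= C' /\ forall n x y w, reach g E n x y ->
  ~ basin g E e (n + M1) x -> basin g E e (n + M1) w ->
  exists z n' k, [/\ segment x w z, lat k, reach g E n' z (e + k),
    (n <= n' <= n + M1 + m.+1)%N & `|e + k - y| <= C'].
Proof.
have [B B0 hB] := reach_displacement gh hE.
exists (`|C| + (M1 + m.+1)%:R * B); split.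
  by rewrite addr_ge0// mulr_ge0// ltW.
move=> n x y w hy nx hw.
have [eta eta0 hnear] := basin_near gh hE lk0 loop (n + M1).
have [z [xwz out [p hp zp]]] := first_entry eta0 nx hw.
have [j [k [hj lk hz]]] := hnear _ _ hp zp.
have hnj : (n + M1 < j)%N.
  rewrite ltnNge; apply/negP => hj'; apply: (out z); first exact: segment_end.
  by exists j, k.
have jn : j = (n + (j - n))%N by lia.
exists z, j, k; split=> //; first by lia.
move: hz; rewrite jn => /reach_split[u hu hue].
have Sc := connected_reach (n := n) gh hE (@segment_is_connected _ x z).
have nS q : [set y0 | exists2 x0, segment x z x0 & reach g E n x0 y0] q ->
    ~ basin g E e M0 q.
  move=> [s hs hq] [i [k' [hi lk' hr]]]; apply: (out s) => //.
  exists (n + i)%N, k'; split=> //; last exact: reach_add hr.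
  by rewrite leq_add2l (leq_trans hi)// leq_addr.
have d1 : `|u - y| <= C.
  apply: (confined Sc nS).
    by exists z => //; exact: segment_end.
  by exists x => //; exact: segment_start.
have d2 := hB _ _ _ hue.
have -> : e + k - y = (e + k - u) + (u - y) by rewrite addrA subrK.
apply: le_trans (ler_normD _ _) _; rewrite addrC; apply: lerD.
  exact: le_trans d1 (ler_norm _).
by apply: le_trans d2 _; apply: ler_wpM2r; [exact: ltW|rewrite ler_nat; lia].
Qed.

(** The induction keeps the pseudo-orbit as long as [e] can be reached in the
remaining time, up to a constant; at the first point where this fails, that
point is replaced inside its noise ball by [shadowing]. When it fails from the
start, the starting point is moved along a segment towards a nearby translate
of [e]. The last clause lets a pseudo-orbit that starts at [e] keep its start. *)
Lemma redirect_end : exists N C', forall n x y, reach g E n x y ->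
  exists x' n' k, [/\ lat k, reach g E n' x' (e + k), (n <= n' <= n + N)%N,
    `|(e + k - x') - (y - x)| <= C' :> R &
    forall l, lat l -> x = e + l -> x' = x].
Proof.
have [B B0 hB] := reach_displacement gh hE.
have [Cs [Cs0 hshadow]] := shadowing.
pose N := (M1 + m.+2)%N.
pose Cr := Cs + (M1 + m.+1)%:R * B.
have claim n : forall x y, reach g E n x y -> basin g E e (n + M1) x ->
    exists n' k, [/\ lat k, reach g E n' x (e + k), (n <= n' <= n + N)%N &
      `|e + k - y| <= Cr].
  elim: n => [|n IH] x y.
    move=> /= -> [j [k [hj lk hr]]]; exists j, k; split=> //; first by rewrite /N; lia.
    apply: le_trans (hB _ _ _ hr) _; rewrite /Cr ler_wpDl//.
    by apply: ler_wpM2r; [exact: ltW|rewrite ler_nat; lia].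
  move=> /reach_head[x1 Ex1 hy] hx.
  have [hx1|hx1] := pselect (basin g E e (n + M1) x1).
    have [n' [k [lk hr hn' hk]]] := IH _ _ hy hx1.
    by exists n'.+1, k; split=> //; exact: reach_cons hr.
  (* if x is a translate of e, the loop provides the next point *)
  have [w Ew hw] : exists2 w, E (w - g x) & basin g E e (n + M1) w.
    case: hx => -[|j] [k [hj lk]]; last first.
      by move=> /reach_head[w Ew hw]; exists w => //; exists j, k; split=> //; lia.
    move=> /= xe; have := reach_lat gh lk loop; rewrite xe => /reach_head[w Ew hw].
    exists w => //; exists m, (k0 + k); split; [by rewrite /M1; lia|exact: latD|].
    by rewrite addrA.
  have [z [n' [k [xz lk hr hn hk]]]] := hshadow _ _ _ _ hy hx1 hw.
  exists n'.+1, k; split=> //; [|by rewrite /N; lia|].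
    apply: reach_cons hr; apply: (noise_convex hE Ex1 Ew).
    case: xz => t t01 ->; exists t => //.
    by apply: plane_eq; rewrite !coordE; ring.
  by apply: le_trans hk _; rewrite /Cr lerDl mulr_ge0// ltW.
have Cr0 : 0 <= Cr by rewrite addr_ge0// mulr_ge0// ltW.
exists N, (Cr + 1) => n x y hy.
have [hx|hx] := pselect (basin g E e (n + M1) x).
  have [n' [k [lk hr hn' hk]]] := claim _ _ _ hy hx.
  exists x, n', k; split=> //.
  by rewrite opprB addrA subrK; apply: le_trans hk _; rewrite lerDl.
(* e + l is a translate of e at distance at most 1 from x *)
have [l ll hl] := lat_floor (x - e).
have hw : basin g E e (n + M1) (e + l) by exists 0%N, l.
have [z [n' [k [[t /andP[t0 t1] zE] lk hr hn' hk]]]] := hshadow _ _ _ _ hy hx hw.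
exists z, n', k; split=> //; first by rewrite /N; lia.
- have -> : e + k - z - (y - x) = (e + k - y) - (z - x).
    by apply: plane_eq; rewrite !coordE; ring.
  apply: le_trans (ler_normB _ _) _; apply: lerD.
    by apply: le_trans hk _; rewrite /Cr lerDl mulr_ge0// ltW.
  rewrite zE addrAC subrr add0r normrZ ger0_norm// -[leRHS]mulr1.
  apply: ler_pM => //; rewrite distrC opprD addrA.
  case: hl; rewrite !coordE => /andP[? ?] /andP[? ?].
  by apply/norm_leP; rewrite !coordE !ler_norml; split; apply/andP; split; lra.
- move=> l' ll' xE; case: hx; exists 0%N, l'; split=> //.
Qed.

End Forward.
End Reach.

(** * Loops at a hub and convexity *)

Section Loops.
Variable R : realType.
Implicit Types (p q x y z k l e : plane R) (g h : plane R -> plane R) (E S : set (plane R)).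

Definition pseudo_displacements g E (n : nat) : set (plane R) :=
  [set v | exists x y, reach g E n x y /\ v = n%:R^-1 *: (y - x)].

Lemma limit_setP (D : nat -> set (plane R)) v : limit_set D v <->
  forall N (eta : R), 0 < eta -> exists n w, [/\ (N <= n)%N, (0 < n)%N, D n w & `|w - v| < eta].
Proof.
split=> [h N eta e0|h N /= N0 B /nbhs_plane[r r0 hr]].
  have [w [[n /= Nn Dw] wv]] : (\bigcup_(n in [set n | (maxn N 1 <= n)%N]) D n) `&`
      [set w | `|w - v| < eta] !=set0.
    apply: (h (maxn N 1)); first by rewrite /= leq_max orbT.
    by apply/nbhs_plane; exists eta.
  exists n, w; split=> //; first exact: leq_trans (leq_maxl _ _) Nn.
  exact: leq_trans (leq_maxr _ _) Nn.
have [n [w [Nn n0 Dw wv]]] := h N r r0.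
by exists w; split; [exists n|exact: hr].
Qed.

Section LoopSemigroup.
Variables (g h : plane R -> plane R) (E : set (plane R)) (e : plane R) (N : nat) (C : R).
Hypotheses (gh : lift_homeo g h) (hE : noise_set E).
Hypothesis near_loop : forall n x y, reach g E n x y -> exists n' k,
  [/\ lat k, reach g E n' e (e + k), (n <= n' <= n + N)%N & `|k - (y - x)| <= C].

Definition loop n k := lat k /\ reach g E n e (e + k).

Lemma loop_add n n' k k' : loop n k -> loop n' k' -> loop (n + n') (k + k').
Proof.
move=> [lk hk] [lk' hk']; split; first exact: latD.
apply: reach_add hk _; rewrite (addrC k) addrA; exact: reach_lat gh lk hk'.
Qed.

Lemma loop_mul n k (q : nat) : loop n k -> loop (q * n) (k *+ q).
Proof.
move=> hk; elim: q => [|q IH]; first by split; [exact: lat0|rewrite mul0n mulr0n addr0].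
by rewrite mulSn mulrS; exact: loop_add.
Qed.

(** Repeating loops gives one inclusion. For the other one, a bounded change of
length and displacement does not affect quotients of long pseudo-orbits. *)
Lemma limit_loopP v : limit_set (pseudo_displacements g E) v <->
  forall eta : R, 0 < eta -> exists n k,
    [/\ (0 < n)%N, loop n k & `|n%:R^-1 *: k - v| < eta].
Proof.
rewrite limit_setP; split=> [hv eta e0|hv M eta e0]; last first.
  have [n [k [n0 hk kv]]] := hv _ e0; exists (M.+1 * n)%N, (n%:R^-1 *: k); split=> //.
  - by rewrite mulSn; nia.
  - by rewrite muln_gt0 n0.
  have [_ hr] := loop_mul M.+1 hk.
  exists e, (e + k *+ M.+1); split=> //.
  rewrite addrAC subrr add0r -[k *+ _]scaler_nat scalerA natrM; congr (_ *: _).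
  by rewrite invfM mulrAC mulVf ?mul1r// pnatr_eq0.
have [B B0 hB] := reach_displacement gh hE.
pose D := `|C| + N%:R * B; have D0 : 0 <= D by rewrite addr_ge0// mulr_ge0// ltW.
have e2 : 0 < eta / 2 by rewrite divr_gt0.
have [n [_ [hn n0 [x [y [hr ->]]] hnv]]] := hv (Num.truncn (D / (eta / 2))).+1 _ e2.
have [n' [k [lk hk /andP[hn1 hn2] hd]]] := near_loop hr.
exists n', k; split=> //; first exact: leq_trans hn1.
set d := y - x in hnv hd *.
have np : 0 < n%:R :> R by rewrite ltr0n.
have n'p : 0 < n'%:R :> R by rewrite ltr0n (leq_trans n0).
have hdn : `|d| <= n%:R * B by exact: hB hr.
have -> : n'%:R^-1 *: k - v = (n%:R^-1 *: d - v)
    + n'%:R^-1 *: ((k - d) - ((n'%:R - n%:R) / n%:R) *: d).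
  by apply: plane_eq; rewrite !coordE; field; rewrite !gt_eqF.
apply: le_lt_trans (ler_normD _ _) _; rewrite [eta]splitr; apply: ltr_leD => //.
rewrite normrZ gtr0_norm ?invr_gt0// mulrC ler_pdivrMr//.
apply: (@le_trans _ _ D).
  apply: le_trans (ler_normB _ _) _; rewrite normrZ; apply: lerD.
    exact: le_trans hd (ler_norm _).
  have dn : 0 <= (n'%:R - n%:R) / n%:R :> R.
    by apply: divr_ge0; rewrite ?subr_ge0 ?ler_nat// ltW.
  rewrite ger0_norm//.
  apply: (@le_trans _ _ (N%:R / n%:R * (n%:R * B))).
    apply: ler_pM => //.
    by rewrite ler_pM2r ?invr_gt0// lerBlDl -natrD ler_nat.
  by rewrite mulrA divfK ?gt_eqF.
have : D / (eta / 2) <= n'%:R.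
  apply: le_trans (ltW (Num.Theory.truncnS_gt _)) _; rewrite ler_nat.
  exact: leq_trans hn1.
by rewrite ler_pdivrMr// mulrC.
Qed.

(** To approximate a convex combination of the quotients of two loops, concatenate
copies of them in the right proportion of total lengths. *)
Lemma convex_of_near_loop : convex_set (limit_set (pseudo_displacements g E)).
Proof.
move=> v w t; rewrite !inE => /limit_loopP hv /limit_loopP hw.
apply/limit_loopP => eta e0.
have e2 : 0 < eta / 2 by rewrite divr_gt0.
have [n1 [k1 [n10 L1 d1]]] := hv _ e2.
have [n2 [k2 [n20 L2 d2]]] := hw _ e2.
have [t0 t1] : 0 <= t%:num /\ t%:num <= 1 by split.
set s := t%:num in t0 t1.
have -> : conv t v w = s *: (v : plane R) + (1 - s) *: (w : plane R) by [].
(* the weight of v is approximated by a / q *)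
pose q := (Num.truncn (`|(v : plane R) - w| / (eta / 2))).+1.
have qp : 0 < q%:R :> R by rewrite ltr0n.
pose a := Num.truncn (s * q%:R).
have sq0 : 0 <= s * q%:R by rewrite mulr_ge0.
have /andP[a1 a2] : a%:R <= s * q%:R < a.+1%:R by exact: Num.Theory.truncn_itv.
have aq : (a <= q)%N.
  rewrite -(ler_nat R); apply: le_trans a1 _; rewrite ler_piMl// ltW//.
exists (q * n1 * n2)%N, (k1 *+ (a * n2) + k2 *+ ((q - a) * n1)); split.
- by rewrite !muln_gt0 n10 n20.
- have -> : (q * n1 * n2 = a * n2 * n1 + (q - a) * n1 * n2)%N by nia.
  by apply: loop_add; apply: loop_mul.
have n1p : 0 < n1%:R :> R by rewrite ltr0n.
have n2p : 0 < n2%:R :> R by rewrite ltr0n.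
have [r rE] : exists r : R, r = a%:R / q%:R by exists (a%:R / q%:R).
have r0 : 0 <= r by rewrite rE divr_ge0.
have r1 : r <= 1 by rewrite rE ler_pdivrMr// mul1r ler_nat.
have -> : (q * n1 * n2)%:R^-1 *: (k1 *+ (a * n2) + k2 *+ ((q - a) * n1))
    - (s *: (v : plane R) + (1 - s) *: (w : plane R)) =
    r *: (n1%:R^-1 *: k1 - (v : plane R)) + (1 - r) *: (n2%:R^-1 *: k2 - (w : plane R))
    + (r - s) *: ((v : plane R) - w).
  rewrite -[k1 *+ _]scaler_nat -[k2 *+ _]scaler_nat !natrM natrB// rE.
  by apply: plane_eq; rewrite !coordE; field; rewrite !gt_eqF.
have hrs : `|r - s| <= q%:R^-1.
  have h1 : r <= s by rewrite rE ler_pdivrMr.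
  have h2 : s - q%:R^-1 <= r.
    rewrite rE ler_pdivlMr// mulrBl mulVf ?gt_eqF//.
    by move: a2; rewrite -addn1 natrD; lra.
  rewrite ler_norml; apply/andP; split; have := invr_gt0 (q%:R : R); rewrite qp; lra.
apply: le_lt_trans (ler_normD _ _) _; rewrite [eta]splitr; apply: ler_ltD.
  apply: le_trans (ler_normD _ _) _; rewrite !normrZ (ger0_norm r0) ger0_norm ?subr_ge0//.
  have h1 : r * `|n1%:R^-1 *: k1 - (v : plane R)| <= r * (eta / 2).
    by apply: ler_wpM2l => //; exact: ltW.
  have h2 : (1 - r) * `|n2%:R^-1 *: k2 - (w : plane R)| <= (1 - r) * (eta / 2).
    by apply: ler_wpM2l; [rewrite subr_ge0|exact: ltW].
  by apply: le_trans (lerD h1 h2) _; lra.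
rewrite normrZ; apply: (@le_lt_trans _ _ (q%:R^-1 * `|(v : plane R) - w|)).
  exact: ler_wpM2r.
rewrite mulrC ltr_pdivrMr// [_ * q%:R]mulrC -ltr_pdivrMr//.
exact: Num.Theory.truncnS_gt.
Qed.

End LoopSemigroup.

(** By [reach_inv], the points that lead to [g e] under [h] are the images under [g]
of those to which [e] leads under [g]; the last clause thus concerns the points
reached from [e], and the roles of [g] and [h] are symmetric. *)
Definition hub g h E e :=
  [/\ exists m k, lat k /\ reach g E m.+1 e (e + k),
      full (\bigcup_M basin g E e M) & full (\bigcup_M basin h E (g e) M)].

Lemma hub_confined g h E e : lift_homeo g h -> noise_set E ->
  (exists m k, lat k /\ reach g E m.+1 e (e + k)) -> full (\bigcup_M basin g E e M) ->
  exists M C, forall S, connected S -> (forall p, S p -> ~ basin g E e M p) ->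
    forall b d, S b -> S d -> `|b - d| <= C :> R.
Proof.
move=> gh hE [m [k [lk loop]]]; apply: full_bounded.
- exact: basin_mono.
- by move=> M; exact: (basin_invariant gh).
move=> M p Mp; exists (M + m.+1)%N.
by have [eta e0 he] := basin_near gh hE lk loop M; exists eta => // q; exact: he.
Qed.

(** First redirect the beginning to [e], by [redirect_end] for the inverse map and
the base point [g e], then redirect the end, which leaves the beginning in
place. *)
Lemma hub_convex g h E e : lift_homeo g h -> noise_set E -> hub g h E e ->
  convex_set (limit_set (pseudo_displacements g E)).
Proof.
move=> gh hE [loop ful1 ful2].
have hg := lift_homeo_sym gh.
have loop' : exists m k, lat k /\ reach h E m.+1 (g e) (g e + k).
  have [m [k [lk hl]]] := loop; exists m, (- k); split; first exact: latN.
  have := reach_lat hg (latN lk) (reach_inv gh hE hl).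
  by rewrite (lift_per gh)// addrK.
have [Mg [Cg cg]] := hub_confined gh hE loop ful1.
have [Mh [Ch ch]] := hub_confined hg hE loop' ful2.
have [m [k0 [lk0 hl]]] := loop; have [m' [k0' [lk0' hl']]] := loop'.
have [N1 [C1 r1]] := redirect_end hg hE lk0' hl' ch.
have [N2 [C2 r2]] := redirect_end gh hE lk0 hl cg.
have [B B0 hB] := lift_displacement gh; have [B' B'0 hB'] := lift_displacement hg.
apply: (@convex_of_near_loop g h E e (N1 + N2) (C1 + C2 + B' + 3 * B) gh hE).
move=> n x y /(reach_inv gh hE)/r1[x' [n1 [k1 [lk1 hr1 /andP[a1 a2] d1 _]]]].
have := reach_lat gh (latN lk1) (reach_inv hg hE hr1).
rewrite (lift_inv_per gh)// (lift_gK gh) addrK => /r2[x'' [n2 [k2 [lk2 hr2 /andP[b1 b2] d2 he]]]].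
have xe : x'' = e by apply: (he 0); [exact: lat0|rewrite addr0].
rewrite xe in hr2 d2; exists n2, k2; split=> //; first by apply/andP; split; lia.
have -> : k2 - (y - x) = (e + k2 - e - (h x' - k1 - e)) + (h x' - x') + (g e - e)
    - (g e + k1 - x' - (g x - g y)) - (g x - x) + (g y - y).
  by apply: plane_eq; rewrite !coordE; ring.
apply: le_trans (ler_normD _ _) _.
apply: le_trans (lerD (ler_normB _ _) (lexx _)) _.
apply: le_trans (lerD (lerD (ler_normB _ _) (lexx _)) (lexx _)) _.
apply: le_trans (lerD (lerD (lerD (ler_normD _ _) (lexx _)) (lexx _)) (lexx _)) _.
apply: le_trans (lerD (lerD (lerD (lerD (ler_normD _ _) (lexx _)) (lexx _)) (lexx _)) (lexx _)) _.
have := hB e; have := hB x; have := hB y; have := hB' x'; lra.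
Qed.

End Loops.

(** * Futures of points *)

Section Futures.
Variable R : realType.
Implicit Types (p q x y z k l e : plane R) (g h : plane R -> plane R) (E S : set (plane R)).

(** Two of the points fall into the same small cell of the torus. *)
Lemma lattice_pigeonhole (delta : R) : 0 < delta -> exists N : nat, forall u : nat -> plane R,
  exists i j l, [/\ (i < j <= N)%N, lat l & `|u j - u i - l| < delta].
Proof.
move=> d0; pose K := (Num.truncn delta^-1).+1.
have K0 : 0 < K%:R :> R by rewrite ltr0n.
have Kd : K%:R^-1 < delta.
  by rewrite -[delta]invrK ltf_pV2 ?posrE ?invr_gt0//; exact: Num.Theory.truncnS_gt.
exists #|{: 'I_K.+1 * 'I_K.+1}| => u.
have /boolp.choice[s hs] : forall i : nat, exists v, lat (u i - v) /\ unit_square v.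
  move=> i; have [l ll hl] := lat_floor (u i).
  by exists (u i - l); rewrite opprB addrC subrK.
pose cell (t : R) : 'I_K.+1 := inord (Num.truncn (K%:R * t)).
have cellP t t' : 0 <= t <= 1 -> 0 <= t' <= 1 -> cell t = cell t' -> `|t - t'| < delta.
  move=> /andP[t0 t1] /andP[t'0 t'1] /(congr1 (@nat_of_ord _)).
  have tr (v : R) : 0 <= v -> v <= 1 -> (cell v : nat) = Num.truncn (K%:R * v).
    move=> v0 v1; rewrite /cell inordK// ltnS -(ler_nat R).
    have /andP[h1 _] := Num.Theory.truncn_itv (mulr_ge0 (ltW K0) v0).
    apply: le_trans h1 _.
    by rewrite ler_piMr// ltW.
  rewrite !tr// => E.
  have /andP[a1 a2] := Num.Theory.truncn_itv (mulr_ge0 (ltW K0) t0).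
  have /andP[b1 b2] := Num.Theory.truncn_itv (mulr_ge0 (ltW K0) t'0).
  rewrite E in a1 a2; apply: lt_trans Kd.
  rewrite -[ltRHS]mul1r ltr_pdivlMr// -[X in _ * X](gtr0_norm K0) -normrM mulrBl.
  rewrite ltr_norml; apply/andP; move: a2 b2; rewrite -[_.+1]addn1 natrD; lra.
pose f (i : 'I_(#|{: 'I_K.+1 * 'I_K.+1}|.+1)) := (cell (cx (s i)), cell (cy (s i))).
have /injectivePn[i [j ij fij]] : ~~ injectiveb f.
  by apply/negP => /injectiveP/leq_card; rewrite card_ord ltnn.
wlog lij : i j ij fij / (i < j)%N.
  move=> W; have [h|h|h] := ltngtP i j; first exact: (W i j).
    by apply: (W j i) => //; rewrite eq_sym.
  by move: ij; rewrite (val_inj h) eqxx.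
exists i, j, ((u j - s j) - (u i - s i)); split.
- by rewrite lij -ltnS ltn_ord.
- by apply: latB; have [] := hs i; have [] := hs j.
have -> : u j - u i - (u j - s j - (u i - s i)) = s j - s i.
  by apply: plane_eq; rewrite !coordE; ring.
have [_ [hx hy]] := hs i; have [_ [hx' hy']] := hs j.
case: fij => fx fy.
by apply/norm_ltP; rewrite !coordE; split; apply: cellP.
Qed.

Definition future g E x : set (plane R) :=
  [set y | exists n k, lat k /\ reach g E n.+1 x (y + k)].

Section FutureTheory.
Variables (g h : plane R -> plane R) (E : set (plane R)).
Hypotheses (gh : lift_homeo g h) (hE : noise_set E).

Lemma future_invariant x : lat_invariant (future g E x).
Proof.
move=> y l ll [n [k [lk hr]]]; exists n, (k - l); split; first exact: latB.
by rewrite addrACA subrr addr0.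
Qed.

Lemma future_ball x w y : future g E x w \/ w = x -> E (y - g w) -> future g E x y.
Proof.
move=> [[n [k [lk hr]]]|->] Ey; last first.
  by exists 0%N, 0; split; [exact: lat0|rewrite addr0; apply/reach1].
exists n.+1, k; split=> //; exists (w + k) => //.
by rewrite (lift_per gh)// opprD addrACA subrr addr0.
Qed.

Lemma future_step x y : future g E x y -> future g E x (g y).
Proof. by move=> fy; apply: (future_ball (or_introl fy)); rewrite subrr; exact: noise0. Qed.

Lemma future_start x : future g E x (g x).
Proof. by apply: (future_ball (or_intror erefl)); rewrite subrr; exact: noise0. Qed.

Lemma future_iter x n : future g E x (iter n.+1 g x).
Proof. by elim: n => [|n IH]; [exact: future_start|exact: future_step]. Qed.

(** The last step of a pseudo-orbit can be modified by any noise. This thickness of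
futures, uniform over all points, makes the pigeonhole principle effective. *)
Lemma future_center x y : future g E x y ->
  exists c, [/\ future g E x c, E (y - c) & forall w, E (w - c) -> future g E x w].
Proof.
move=> [n [k [lk [w hw Ew]]]].
have hw' : future g E x (w - k) \/ w - k = x - k.
  case: n hw => [|n] hw; first by right; rewrite hw.
  by left; exists n, k; rewrite subrK.
have E' : y + k - g w = y - g (w - k).
  rewrite (lift_per gh _ (latN lk)); apply: plane_eq; rewrite !coordE; ring.
have B v : E (v - g (w - k)) -> future g E x v.
  case: hw' => [hw' Ev|->]; first exact: (future_ball (or_introl hw')).
  rewrite (lift_per gh _ (latN lk)) => Ev.
  rewrite -[v](addrK k); apply: future_invariant; first exact: latN.
  by apply: (future_ball (or_intror erefl)); rewrite -addrA -opprB.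
exists (g (w - k)); split; [|by rewrite -E'|exact: B].
by apply: B; rewrite subrr; exact: noise0.
Qed.

Lemma future_open x : open (future g E x).
Proof.
apply: open_ballP => y /future_center[c [_ Ey hc]].
have [r r0 hr] := noise_near hE Ey; exists r => // q qy; apply/hc/hr.
by rewrite opprB addrA subrK.
Qed.

Lemma future_reach n x y : reach g E n x y -> future g E y `<=` future g E x.
Proof.
move=> hr w [m [k [lk hm]]]; exists (n + m)%N, k; split=> //.
by rewrite -addnS; exact: reach_add hm.
Qed.

End FutureTheory.
End Futures.

(** * Components of a future *)

Section Components.
Variable R : realType.
Implicit Types (p q x y z k l e : plane R) (g h : plane R -> plane R) (E S : set (plane R)).

Definition plane_linear (f : plane R -> R) (c : R) :=
  [/\ 0 <= c, forall p q, f (p - q) = f p - f q & forall p, `|f p| <= c * `|p|].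

Lemma plane_linear_det k : plane_linear (det k) (`|cx k| + `|cy k|).
Proof. by split; [rewrite addr_ge0|exact: detB|exact: norm_det]. Qed.

Lemma plane_linear_dot k : plane_linear (dot k) (`|cx k| + `|cy k|).
Proof. by split; [rewrite addr_ge0|exact: dotB|exact: norm_dot]. Qed.

Lemma plane_linear_ivt f c U p q (v : R) : plane_linear f c -> connected U ->
  U p -> U q -> f p <= v <= f q -> exists2 u, U u & f u = v.
Proof.
move=> [c0 fB fc] Uc Up Uq pvq.
have /connected_intervalP : connected (f @` U).
  apply: connected_continuous_connected => //; apply: continuous_subspaceT => a.
  move=> B /nbhs_ballP[eps /= eps0 hB]; apply/nbhs_plane.
  have c1 : 0 < c + 1 by rewrite ltr_wpDl.
  exists (eps / (c + 1)); first by rewrite divr_gt0.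
  move=> b ba; apply: hB; rewrite /ball/= -fB; apply: le_lt_trans (fc _) _.
  apply: (@le_lt_trans _ _ ((c + 1) * `|b - a|)).
    by rewrite distrC; apply: ler_wpM2r => //; rewrite lerDl.
  by rewrite mulrC -ltr_pdivlMr.
move=> /(_ (f p) (f q)) H; have [||u Uu fu] := H _ _ v pvq.
- by exists p.
- by exists q.
by exists u.
Qed.

Section Component.
Variables (g h : plane R -> plane R) (E : set (plane R)) (x y : plane R).
Hypotheses (gh : lift_homeo g h) (hE : noise_set E) (Ay : future g E x y).

Let A := future g E x.
Let U := connected_component A y.

Lemma comp_start : U y. Proof. exact: connected_component_refl. Qed.

Lemma comp_sub : U `<=` A. Proof. exact: connected_component_sub. Qed.

Lemma comp_connected : connected U. Proof. exact: component_connected. Qed.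

Lemma comp_absorb S p : connected S -> S `<=` A -> S p -> U p -> S `<=` U.
Proof.
move=> Sc SA Sp Up; rewrite /U (same_connected_component Up).
exact: connected_component_max.
Qed.

(** A translate of the component that meets it is absorbed by it. *)
Lemma comp_shift l p : lat l -> U p -> U (p + l) -> forall q, U q -> U (q + l).
Proof.
move=> ll Up Upl q Uq.
apply: (@comp_absorb (translate l U) (p + l)) => //.
- apply: connected_translate; exact: comp_connected.
- by move=> _ [w Uw <-]; apply: future_invariant => //; exact: comp_sub.
- by exists p.
- by exists q.
Qed.

Lemma comp_center u : U u ->
  exists c, [/\ U c, E (u - c) & forall w, E (w - c) -> U w].
Proof.
move=> Uu; have [c [Ac Euc hc]] := future_center gh hE (comp_sub Uu).
have cE w : E (w - c) -> U w.
  move=> Ew; apply: (@comp_absorb (translate c E) u) => //.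
  - by apply: connected_translate; apply: convex_connected => a b; exact: noise_convex.
  - by move=> _ [v Ev <-]; apply: hc; rewrite addrK.
  - by exists (u - c) => //; rewrite subrK.
  - by exists (w - c) => //; rewrite subrK.
by exists c; split=> //; apply: cE; rewrite subrr; exact: noise0.
Qed.

Lemma comp_open u : U u -> exists2 r : R, 0 < r & forall q, `|q - u| < r -> U q.
Proof.
move=> /comp_center[c [_ Euc hc]]; have [r r0 hr] := noise_near hE Euc.
by exists r => // q qu; apply/hc/hr; rewrite opprB addrA subrK.
Qed.

(** If [f] varied more, intermediate values would provide N + 1 points of the
component with well separated values of [f], each with a noise ball in the
component. Two of them would agree up to an integer vector [l] and a small
error; then [l] would translate the component into itself although [f l] is
not zero. *)
Lemma comp_width (r D : R) N : 0 < r -> (forall v, `|v| < r -> E v) ->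
  (forall v, E v -> `|v| <= D) ->
  (forall u : nat -> plane R,
     exists i j l, [/\ (i < j <= N)%N, lat l & `|u j - u i - l| < r]) ->
  forall f c, plane_linear f c -> (forall l, lat l -> U (y + l) -> f l = 0) ->
  forall u v, U u -> U v -> `|f u - f v| <= N%:R * (2 * c * D + c * r + 1).
Proof.
move=> r0 hr hD pig f c [c0 fB fc] hf.
(* the spacing exceeds the variation of f over two noise balls and a small error *)
set s := 2 * c * D + c * r + 1.
have D0 : 0 <= D by rewrite (le_trans _ (hD _ (noise0 hE))).
have cD0 : 0 <= c * D by rewrite mulr_ge0.
have cr0 : 0 <= c * r by rewrite mulr_ge0// ltW.
have s0 : 0 < s by rewrite /s -mulrA; lra.
suff key u v : U u -> U v -> f v - f u <= N%:R * s.
  by move=> u v Uu Uv; rewrite ler_norml; have := key _ _ Uu Uv; have := key _ _ Uv Uu; lra.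
move=> Uu Uv; rewrite leNgt; apply/negP => big.
have cent i : exists w, (i <= N)%N ->
    [/\ U w, `|f w - (f u + i%:R * s)| <= c * D & forall q, E (q - w) -> U q].
  have [iN|] := leqP i N; last by exists 0.
  have [|p Up fp] := @plane_linear_ivt f c U u v (f u + i%:R * s) (And3 c0 fB fc) comp_connected Uu Uv.
  - rewrite lerDl mulr_ge0 ?(ltW s0)//=.
    have : i%:R * s <= N%:R * s by rewrite ler_pM2r// ler_nat.
    lra.
  have [w [Uw Epw hw]] := comp_center Up; exists w; split=> //.
  rewrite -fp distrC -fB; apply: le_trans (fc _) _.
  by apply: ler_wpM2l => //; exact: hD.
have /boolp.choice[w hw] := cent.
have [i [j [l [/andP[ij jN] ll close]]]] := pig w.
have iN : (i <= N)%N by apply: leq_trans jN; exact: ltnW.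
have [Uwi fwi hwi] := hw i iN; have [Uwj fwj _] := hw j jN.
have Ujl : U (w j - l).
  by apply: hwi; apply: hr; rewrite addrAC.
have fl : f l = 0.
  apply: hf => //; apply: (@comp_shift l (w j - l)) => //; first by rewrite subrK.
  exact: comp_start.
have := fc (w j - w i - l); rewrite !fB fl subr0 => h1.
have h2 : c * `|w j - w i - l| <= c * r by apply: ler_wpM2l => //; exact: ltW.
have h3 : i%:R * s + s <= j%:R * s.
  by rewrite -{2}[s]mul1r -mulrDl ler_pM2r// natr1 ler_nat.
move: h1 fwi fwj; rewrite !ler_norml => /andP[_ h1] /andP[_ h4] /andP[h5 _].
have : s = 2 * (c * D) + c * r + 1 by rewrite /s; ring.
lra.
Qed.

End Component.

Section Iterates.
Variables (g h : plane R -> plane R) (E : set (plane R)).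
Hypotheses (gh : lift_homeo g h) (hE : noise_set E).

Lemma iter_cancel n : cancel (iter n g) (iter n h).
Proof.
elim: n => [//|n IH] p; rewrite [iter n.+1 g p]/= iterSr (lift_gK gh); exact: IH.
Qed.

Lemma iter_per n p v : lat v -> iter n g (p + v) = iter n g p + v.
Proof. by move=> lv; elim: n => [//|n IH] /=; rewrite IH (lift_per gh). Qed.

Lemma iter_displacement : exists2 B : R, 0 < B & forall n p, `|iter n g p - p| <= n%:R * B.
Proof.
have [B B0 hB] := reach_displacement gh hE.
by exists B => // n p; apply: hB; exact: reach_orbit gh hE.
Qed.

Lemma iter_cont n : continuous (iter n g).
Proof.
elim: n => [|n IH] p; first exact: cvg_id.
by apply: (@continuous_comp _ _ _ (iter n g) g); [exact: IH|exact: (lift_cont gh)].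
Qed.

End Iterates.

Section Strip.
Variables (g h : plane R -> plane R) (E : set (plane R)) (x y : plane R) (m : nat) (l k : plane R) (W : R).
Hypotheses (gh : lift_homeo g h) (hE : noise_set E) (Ay : future g E x y).
Let U := connected_component (future g E x) y.
Hypotheses (ll : lat l) (GU : forall p, U p -> U (iter m g p - l)).
Hypotheses (lk : lat k) (k0 : k != 0) (Uk : U (y + k)).
Hypothesis strip : forall u, U u -> `|det k u - det k y| <= W.

Let G p := iter m g p - l.
Let G' p := iter m h (p + l).

(* Joining z to arbitrarily low points, not just to one, makes the property
   insensitive to the bounded displacement of G'. *)
Let below z := forall L : R, exists S, [/\ connected S, (forall p, S p -> ~ U p), S z &
  exists2 b, S b & det k b < L].

(** The component is a line in direction [k], and separates the points far above from
those far below. *)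
Lemma not_below_high : exists c : R, forall z, c < det k z -> ~ below z.
Proof.
have Uc : connected U by exact: component_connected.
have Uy : U y by exact: connected_component_refl.
have [||th th0 [_ hch]] := @connected_chain _ (fun _ => U) U y (y + k) _ Uc _ Uy Uk.
  by move=> M M' _ q.
  by move=> p Up; exists 0%N; exact: comp_open gh hE _ Up.
have [||c hc] := @chain_sep _ U k y th k0 _ _ th0 hch.
- by move=> p; exact: (comp_shift lk Uy Uk).
- by move=> p; apply: (comp_shift (latN lk) Uk); rewrite addrK.
exists c => z cz /(_ (- c))[S [Sc SU Sz [b Sb hb]]].
exact: hc Sc SU _ _ Sb Sz hb cz.
Qed.

(** A half-plane under the strip avoids the component. *)
Lemma below_low z : det k z < det k y - W -> below z.
Proof.
move=> hz L; exists [set p | det k p < det k y - W]; split.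
- apply: convex_connected => a b /= ha hb p [t /andP[t0 t1] ->] /=.
  have -> : det k (a + t *: (b - a)) = (1 - t) * det k a + t * det k b.
    by rewrite /det !coordE; ring.
  have [->|t0'] := eqVneq t 0; first by rewrite subr0 mul1r mul0r addr0.
  have tp : 0 < t by rewrite lt_def t0' t0.
  have : t * det k b < t * (det k y - W) by rewrite ltr_pM2l.
  have : (1 - t) * det k a <= (1 - t) * (det k y - W).
    by apply: ler_wpM2l; [rewrite subr_ge0|exact: ltW].
  lra.
- by move=> p /= hp /strip; rewrite ler_norml => /andP[+ _]; lra.
- by [].
have kk := dotkk_gt0 k0.
pose t := (`|det k z - L| + 1) / dot k k.
have t0 : 0 < t by rewrite divr_gt0// ltr_wpDl.
pose n := vec (- cy k) (cx k).
have hn : det k (z - t *: n) = det k z - (`|det k z - L| + 1).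
  have -> : `|det k z - L| + 1 = t * dot k k by rewrite /t divfK// gt_eqF.
  by rewrite /det /dot !coordE; ring.
exists (z - t *: n); rewrite /= hn; have := ler_norm (det k z - L).
  by have := normr_ge0 (det k z - L); lra.
lra.
Qed.

(** The map [G] sends [U] into itself, so its inverse sends the complement of [U]
into itself, and it moves points by a bounded amount. *)
Lemma below_back z : below (G z) -> below z.
Proof.
move=> hz L; have [B B0 hB] := iter_displacement (lift_homeo_sym gh) hE.
pose c := `|cx k| + `|cy k|; pose D := m%:R * B + `|l|.
have hG' p : `|G' p - p| <= D.
  have -> : G' p - p = (iter m h (p + l) - (p + l)) + l.
    by rewrite opprD addrA subrK.
  by apply: le_trans (ler_normD _ _) _; apply: lerD.
have G'K p : G' (G p) = p by rewrite /G' /G subrK (iter_cancel gh).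
have GK' p : G (G' p) = p.
  by rewrite /G' /G (iter_cancel (lift_homeo_sym gh)) addrK.
have [S [Sc SU Sz [b Sb hb]]] := hz (L - c * D).
exists (G' @` S); split.
- apply: connected_continuous_connected => //; apply: continuous_subspaceT.
  apply/plane_continuousP => p e e0.
  have ic : continuous (iter m h) by exact: (iter_cont (lift_homeo_sym gh)).
  have [r r0 hr] := (plane_continuousP _).1 ic (p + l) e e0.
  by exists r => // q qp; apply: hr; rewrite opprD addrACA subrr addr0.
- by move=> _ [p Sp <-] /GU; rewrite -/(G _) GK'; exact: SU.
- by exists (G z).
exists (G' b); first by exists b.
have : `|det k (G' b - b)| <= c * D.
  apply: le_trans (norm_det _ _) _; apply: ler_wpM2l => //; exact: addr_ge0.
rewrite detB ler_norml => /andP[_]; lra.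
Qed.

(** Points above the strip cannot be carried below it by [below_back]; every point is
above the strip after an integer translation of controlled size. *)
Lemma strip_drift : exists C : R, forall n z, - C <= det k (iter n G z) - det k z.
Proof.
have [c hc] := not_below_high.
have Gper n p v : lat v -> iter n G (p + v) = iter n G p + v.
  move=> lv; elim: n => [//|n IH] /=; rewrite IH /G (iter_per gh)//.
  by rewrite addrAC.
have up n z : c < det k z -> det k y - W <= det k (iter n G z).
  move=> cz; rewrite leNgt; apply/negP => /below_low hb.
  suff : below z by exact: hc.
  by elim: n hb => [//|n IH] /below_back.
pose v := vec (- cy k) (cx k).
have lv : lat v.
  by have [h1 h2] := (latP k).1 lk; apply/latP; rewrite !coordE rpredN.
have dv : det k v = dot k k by rewrite /det /dot !coordE; ring.
have kk := dotkk_gt0 k0.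
exists (c + dot k k - (det k y - W)) => n z.
(* the translation of z by j v lies above the strip, within one period *)
pose j : int := Num.floor ((c - det k z) / dot k k) + 1.
have dj : det k (v *~ j) = dot k k * j%:~R by rewrite detMz dv mulrzr.
have /andP[f1 f2] := Num.Theory.floor_itv ((c - det k z) / dot k k).
have j1 : c < det k (z + v *~ j).
  by move: f2; rewrite -/j ltr_pdivrMr// detD dj; lra.
have j2 : det k (z + v *~ j) <= c + dot k k.
  by move: f1; rewrite ler_pdivlMr// detD dj /j intrD1; lra.
have := up n _ j1; rewrite Gper; last exact: lat_Mz.
move: j2; rewrite !detD; lra.
Qed.

End Strip.
End Components.

(** * Points without a full future *)

Section Dichotomy.
Variable R : realType.
Implicit Types (p q x y z k l e : plane R) (g h : plane R -> plane R) (E S : set (plane R)).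

(** No finite family of lines attracts, up to a bounded error, the displacement of
every orbit segment; an open set of rotation vectors ensures this. *)
Definition spreading g := forall (L : seq (plane R * R)) (C : R),
  (forall ac, ac \in L -> ac.1 != 0) ->
  exists n z, forall ac, ac \in L -> C < `|dot ac.1 (iter n g z - z) - n%:R * ac.2|.

Lemma spreading_inv g h : lift_homeo g h -> spreading g -> spreading h.
Proof.
move=> gh sg L C L0.
have [|n [z hz]] := sg [seq (ac.1, - ac.2) | ac <- L] C.
  by move=> _ /mapP[ac acL ->] /=; exact: L0.
exists n, (iter n g z) => ac acL; rewrite (iter_cancel gh).
have := hz (ac.1, - ac.2) (map_f (fun ac => (ac.1, - ac.2)) acL).
have -> : dot ac.1 (z - iter n g z) - n%:R * ac.2 =
   - (dot (ac.1, - ac.2).1 (iter n g z - z) - n%:R * (ac.1, - ac.2).2).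
  by rewrite /= /dot !coordE; ring.
by rewrite normrN.
Qed.

Definition perp k : plane R := vec (- cy k) (cx k).

Lemma det_perp k p : det k p = dot (perp k) p.
Proof. by rewrite /det /dot !coordE; ring. Qed.

Lemma perp_neq0 k : k != 0 -> perp k != 0.
Proof.
apply: contraNneq => /planeP[]; rewrite !coordE => /eqP; rewrite oppr_eq0 => /eqP hy hx.
by apply/eqP/plane_eq; rewrite coordE.
Qed.

Section OneMap.
Variables (g h : plane R -> plane R) (E : set (plane R)).
Hypotheses (gh : lift_homeo g h) (hE : noise_set E).

Lemma iter_sub_lattice m l n z : lat l ->
  iter n (fun p => iter m g p - l) z = iter (n * m) g z - l *+ n.
Proof.
move=> ll; elim: n => [|n IH]; first by rewrite mul0n mulr0n subr0.
rewrite iterS IH (iter_per gh); last by apply: latN; exact: latMn.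
by rewrite mulSn iterD mulrS opprD addrA addrAC.
Qed.

(** The displacement under [n] iterations is governed by that of the iterates of
g^m - l, up to the remainder of [n] modulo [m]. *)
Lemma iter_floor_error m l (B : R) : (0 < m)%N -> lat l ->
  (forall n p, `|iter n g p - p| <= n%:R * B) -> 0 <= B ->
  forall n z, `|iter n g z - z - (n%:R / m%:R) *: l -
    (iter (n %/ m) (fun p => iter m g p - l) z - z)| <= m%:R * B + `|l|.
Proof.
move=> m0 ll hB B0 n z; rewrite iter_sub_lattice//.
have mp : 0 < m%:R :> R by rewrite ltr0n.
set w := iter (n %/ m * m) g z.
have -> : iter n g z = iter (n %% m) g w by rewrite -iterD addnC -divn_eq.
have rm : (n %% m)%:R <= m%:R :> R by rewrite ler_nat ltnW// ltn_mod.
have -> : iter (n %% m) g w - z - (n%:R / m%:R) *: l - (w - l *+ (n %/ m) - z)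
    = (iter (n %% m) g w - w) - ((n %% m)%:R / m%:R) *: l.
  have -> : n%:R / m%:R = (n %/ m)%:R + (n %% m)%:R / m%:R :> R.
    rewrite {1}(divn_eq n m) natrD natrM; field; exact: lt0r_neq0.
  by rewrite -(scaler_nat _ l); apply: plane_eq; rewrite !coordE; ring.
apply: le_trans (ler_normB _ _) _; apply: lerD.
  by apply: le_trans (hB _ _) _; apply: ler_wpM2r.
have q0 : 0 <= (n %% m)%:R / m%:R :> R by apply: divr_ge0.
rewrite normrZ ger0_norm//; apply: ler_piMl => //.
by rewrite ler_pdivrMr// mul1r.
Qed.

(** By [strip_drift] for [k] and for its opposite, the transverse displacement of all
orbits is a fixed linear function of time up to a bounded error. *)
Lemma strip_not_spreading x y m l k (W : R) : future g E x y ->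
  let U := connected_component (future g E x) y in
  (0 < m)%N -> lat l -> (forall p, U p -> U (iter m g p - l)) ->
  lat k -> k != 0 -> U (y + k) -> (forall u, U u -> `|det k u - det k y| <= W) ->
  ~ spreading g.
Proof.
move=> Ay U m0 ll GU lk k0 Uk strip sg.
have Uy : U y by exact: connected_component_refl.
have Umk : U (y - k) by apply: (comp_shift (latN lk) Uk _ Uy); rewrite addrK.
have [C1 h1] := strip_drift gh hE Ay GU lk k0 Uk strip.
have stripN u : U u -> `|det (- k) u - det (- k) y| <= W.
  have dN p : det (- k) p = - det k p by rewrite /det !coordE; ring.
  by move=> /strip; rewrite !dN -opprD normrN.
have k0' : - k != 0 by rewrite oppr_eq0.
have [C2 h2] := strip_drift gh hE Ay GU (latN lk) k0' Umk stripN.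
have [B B0 hB] := iter_displacement gh hE.
pose c := `|cx k| + `|cy k|.
pose C := `|C1| + `|C2| + c * (m%:R * B + `|l|).
have mp : 0 < m%:R :> R by rewrite ltr0n.
have [|n [z hnz]] := sg [:: (perp k, det k l / m%:R)] C.
  by move=> ac; rewrite inE => /eqP ->; exact: perp_neq0.
have := hnz (perp k, det k l / m%:R); rewrite inE eqxx => /(_ isT) /=.
apply/negP; rewrite -leNgt -det_perp.
have hm := iter_floor_error m0 ll hB (ltW B0) n z.
set v := iter n g z - z in hm *; set w := iter (n %/ m) _ z in hm.
have -> : det k v - n%:R * (det k l / m%:R) = det k (v - (n%:R / m%:R) *: l - (w - z))
    + (det k w - det k z) by rewrite /det !coordE; ring.
apply: le_trans (ler_normD _ _) _; rewrite addrC /C; apply: lerD; last first.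
  by apply: le_trans (norm_det _ _) _; apply: ler_wpM2l => //; exact: addr_ge0.
have := h1 (n %/ m)%N z; have := h2 (n %/ m)%N z; rewrite -/w.
have -> : det (- k) w - det (- k) z = - (det k w - det k z) by rewrite /det !coordE; ring.
move=> a2 a1; have := ler_norm C1; have := ler_norm C2.
have := normr_ge0 C1; have := normr_ge0 C2.
by rewrite ler_norml => *; apply/andP; split; lra.
Qed.

(** The vectors translating the component [U] of an iterate of [x] into itself are
either independent, or parallel to one nonzero vector, or all zero. The second
case is excluded by [strip_not_spreading]; in the third one [U] is bounded by
[comp_width] and is invariant under g^m - l. The constants do not depend on
[x]. *)
Lemma future_dichotomy : spreading g -> exists N (C : R), forall x,
  full (future g E x) \/ exists m k, [/\ (0 < m <= N)%N, lat k &
    forall n, `|iter n g x - x - (n%:R / m%:R) *: k| <= C].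
Proof.
move=> sg.
have [r r0 hr'] := noise_near hE (noise0 hE).
have hr v : `|v| < r -> E v by move=> vr; apply: hr'; rewrite subr0.
have [D hD] := noise_bounded hE.
have D0 : 0 <= D by rewrite (le_trans _ (hD _ (noise0 hE))).
have [N pig] := lattice_pigeonhole r0.
have [B B0 hB] := iter_displacement gh hE.
pose W1 := N%:R * (2 * 2 * D + 2 * r + 1).
pose lmax := N%:R * B + r.
exists N, (W1 + (N%:R + 1) * B + (N%:R + 1) * B + (N%:R * B + lmax)) => x.
have [i [j [l [/andP[ij jN] ll close]]]] := pig (fun i => iter i.+1 g x).
set y := iter i.+1 g x in close.
have Ay : future g E x y by exact: (future_iter gh hE).
pose U := connected_component (future g E x) y.
have Uy : U y by exact: connected_component_refl.
pose m := (j - i)%N; have m0 : (0 < m)%N by rewrite subn_gt0.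
have mN : (m <= N)%N by rewrite (leq_trans (leq_subr _ _)).
have yj : iter j.+1 g x = iter m g y by rewrite /y -iterD /m addnS subnK// ltnW.
rewrite yj in close.
(* y and its return lie in a common noise ball inside the future *)
have Gy : U (iter m g y - l).
  have [c [Uc Eyc hc]] := comp_center gh hE Uy.
  have yEA : translate y E `<=` future g E x.
    move=> _ [v Ev <-]; rewrite /y iterS; apply: (future_ball gh (w := iter i g x)).
      by case: i {ij close yj Ay U Uy m m0 mN Uc Eyc hc y} => [|i]; [right|left; exact: (future_iter gh hE)].
    by rewrite addrK.
  have : translate y E `<=` U.
    apply: (comp_absorb (p := y)) => //.
    - by apply: connected_translate; apply: convex_connected => a b; exact: noise_convex.
    - by exists 0; [exact: noise0|rewrite add0r].
  apply; exists (iter m g y - l - y); last by rewrite subrK.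
  by apply: hr; rewrite addrAC.
have GU p : U p -> U (iter m g p - l).
  move=> Up; apply: (@comp_absorb _ g E x y ((fun p => iter m g p - l) @` U) (iter m g y - l)) => //.
  - apply: connected_continuous_connected; first exact: component_connected.
    apply: continuous_subspaceT; apply/plane_continuousP => q e e0.
    have ic : continuous (iter m g) by exact: (iter_cont gh).
    have [d d0 hd] := (plane_continuousP _).1 ic q e e0.
    by exists d => // q' /hd; rewrite opprD addrACA subrr addr0.
  - move=> _ [q /comp_sub Aq <-]; apply: future_invariant; first exact: latN.
    have fi n : future g E x (iter n g q).
      by elim: n => [//|n IH]; exact: (future_step gh hE).
    exact: fi.
  - by exists y.
  - by exists p.
have width := comp_width gh hE Ay r0 hr hD pig.
pose La := [set v | lat v /\ U (y + v)].
have [[v [v' [[lv Uv] [lv' Uv'] dvv']]]|flat] :=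
    pselect (exists v v', [/\ La v, La v' & det v v' != 0]).
  left; exists v, v', y, U; split=> //; [exact: component_connected|exact: comp_sub].
right; exists m, l; split=> //; first by rewrite m0.
have [[k [[lk Uk] k0]]|nok] := pselect (exists k, La k /\ k != 0).
  exfalso; apply: (strip_not_spreading Ay m0 ll GU lk k0 Uk (W := _)) sg => u Uu.
  apply: (width _ _ (plane_linear_det k)) => // v lv Uv.
  by apply: contrapT => /eqP dv; apply: flat; exists k, v; split.
have bU u : U u -> `|u - y| <= W1.
  move=> Uu; have triv v : lat v -> U (y + v) -> v = 0.
    by move=> lv Uv; apply: contrapT => /eqP v0; apply: nok; exists v.
  have e1 : `|cx (vec 1 0 : plane R)| + `|cy (vec 1 0 : plane R)| = 1.
    by rewrite !coordE normr1 normr0 addr0.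
  have e2 : `|cx (vec 0 1 : plane R)| + `|cy (vec 0 1 : plane R)| = 1.
    by rewrite !coordE normr1 normr0 add0r.
  have z0 a v : lat v -> U (y + v) -> dot a v = 0.
    by move=> lv Uv; rewrite (triv _ lv Uv) /dot !coordE !mulr0 addr0.
  have b1 := width _ _ (plane_linear_dot (vec 1 0)) (z0 _) _ _ Uu Uy.
  have b2 := width _ _ (plane_linear_dot (vec 0 1)) (z0 _) _ _ Uu Uy.
  rewrite e1 -dotB /dot !coordE mul1r mul0r addr0 in b1.
  rewrite e2 -dotB /dot !coordE mul1r mul0r add0r in b2.
  have N0 : 0 <= N%:R :> R by [].
  have W1ge : N%:R * (2 * 1 * D + 1 * r + 1) <= W1.
    by apply: ler_wpM2l => //; have := D0; have := r0; lra.
  by apply/norm_leP; rewrite !coordE; split; [apply: le_trans b1 _|apply: le_trans b2 _].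
have ln : `|l| <= lmax.
  have -> : l = (iter m g y - y) - (iter m g y - y - l) by rewrite opprB addrC subrK.
  apply: le_trans (ler_normB _ _) _; apply: lerD; last exact: ltW.
  by apply: le_trans (hB _ _) _; apply: ler_wpM2r; [exact: ltW|rewrite ler_nat].
move=> n; have hm := iter_floor_error m0 ll hB (ltW B0) n x.
set G := fun p => iter m g p - l in hm.
have GqU (q : nat) : U (iter q G y) by elim: q => [//|q IH]; exact: GU.
have Gq := bU _ (GqU (n %/ m)%N).
have iN : i.+1%:R <= N%:R + 1 :> R.
  by rewrite natr1 ler_nat ltnS (leq_trans _ jN)// ltnW.
have yx : `|y - x| <= (N%:R + 1) * B.
  by apply: le_trans (hB _ _) _; apply: ler_wpM2r => //; exact: ltW.
have Gyx : `|iter (n %/ m) G y - iter (n %/ m) G x| <= (N%:R + 1) * B.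
  rewrite !iter_sub_lattice// opprB addrA subrK /y -iterD addnC iterD.
  by apply: le_trans (hB _ _) _; apply: ler_wpM2r => //; exact: ltW.
set a := iter (n %/ m) G x in hm Gyx; set b := iter (n %/ m) G y in Gq Gyx.
have -> : iter n g x - x - (n%:R / m%:R) *: l =
   (b - y) + (y - x) - (b - a) + (iter n g x - x - (n%:R / m%:R) *: l - (a - x)).
  by apply: plane_eq; rewrite !coordE; ring.
apply: le_trans (ler_normD _ _) _; apply: lerD.
  apply: le_trans (ler_normB _ _) _; apply: lerD => //.
  by apply: le_trans (ler_normD _ _) _; apply: lerD.
apply: le_trans hm _; apply: lerD => //.
by apply: ler_wpM2r; [exact: ltW|rewrite ler_nat].
Qed.

End OneMap.
End Dichotomy.

(** * A rotation set with interior yields a hub *)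

Section Hub.
Variable R : realType.
Implicit Types (p q x y z k l e : plane R) (g h : plane R -> plane R) (E S : set (plane R)).

(** Lines are removed one at a time, keeping a ball at positive distance. *)
Lemma open_avoids_lines (L : seq (plane R * R)) p (r : R) : 0 < r ->
  (forall ac, ac \in L -> ac.1 != 0) ->
  exists p' r' (d : R), [/\ 0 < r', 0 < d, forall q, `|q - p'| < r' -> `|q - p| < r &
    forall ac, ac \in L -> forall q, `|q - p'| < r' -> d <= `|dot ac.1 q - ac.2|].
Proof.
elim: L p r => [|[a c] L IH] p r r0 hL; first by exists p, r, 1; split.
have a0 : a != 0 by apply: (hL (a, c)); rewrite inE eqxx.
have aa := dotkk_gt0 a0.
have na : 0 < `|a| by rewrite normr_gt0.
have [p1 pp1 hp1] : exists2 p1, `|p1 - p| < r & dot a p1 != c.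
  have [pc|pc] := eqVneq (dot a p) c; last first.
    by exists p => //; rewrite subrr normr0.
  pose t := r / (2 * `|a|).
  have t0 : 0 < t by rewrite divr_gt0// mulr_gt0.
  exists (p + t *: a).
    rewrite addrAC subrr add0r normrZ gtr0_norm// /t invfM mulrA divfK ?gt_eqF//.
    by rewrite ltr_pdivrMr// ltr_pMr// ltr1n.
  have -> : dot a (p + t *: a) = c + t * dot a a by rewrite -pc /dot !coordE; ring.
  by rewrite -subr_eq0 addrAC subrr add0r mulf_neq0// gt_eqF.
pose D := `|dot a p1 - c|; have D0 : 0 < D by rewrite normr_gt0 subr_eq0.
pose w := `|cx a| + `|cy a|; have w0 : 0 <= w by exact: addr_ge0.
pose s := Num.min (r - `|p1 - p|) (D / (2 * (w + 1))).
have w1 : 0 < 2 * (w + 1) by rewrite mulr_gt0// ltr_wpDl.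
have s0 : 0 < s by rewrite lt_min subr_gt0 pp1 divr_gt0.
have sr : s <= r - `|p1 - p| by rewrite ge_min lexx.
have sD : s <= D / (2 * (w + 1)) by rewrite ge_min lexx orbT.
have [|p' [r' [d [r'0 d0 h1 h2]]]] := IH p1 s s0.
  by move=> ac acL; apply: hL; rewrite inE acL orbT.
exists p', r', (Num.min d (D / 2)); split=> //.
- by rewrite lt_min d0 divr_gt0.
- move=> q /h1 qp1; have -> : q - p = (q - p1) + (p1 - p) by rewrite addrA subrK.
  by apply: le_lt_trans (ler_normD _ _) _; lra.
move=> ac; rewrite inE => /orP[/eqP ->|acL] q qp; rewrite ge_min; last first.
  by rewrite (h2 _ acL).
apply/orP; right => /=.
have qp1 := h1 _ qp.
have h3 : `|dot a (q - p1)| <= D / 2.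
  apply: le_trans (norm_dot _ _) _; rewrite -/w.
  have : w * `|q - p1| <= w * s by apply: ler_wpM2l => //; exact: ltW.
  have : (w + 1) * s <= D / 2.
    by rewrite mulrC -ler_pdivlMr ?ltr_wpDl// -mulrA -invfM.
  have : 0 <= s by exact: ltW.
  lra.
have : D <= `|dot a q - c| + `|dot a (q - p1)|.
  rewrite /D; have -> : dot a p1 - c = (dot a q - c) - dot a (q - p1) by rewrite dotB; ring.
  exact: ler_normB.
lra.
Qed.

Lemma spreading_interior g : interior (rotation_set g) !=set0 -> spreading g.
Proof.
move=> [p0 /nbhs_plane[r r0 hr]] L C L0.
have [p' [r' [d [r'0 d0 h1 h2]]]] := open_avoids_lines p0 r0 L0.
have /limit_setP : rotation_set g p' by apply/hr/h1; rewrite subrr normr0.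
move=> /(_ (Num.truncn (C / d)).+1 _ r'0)[n [_ [hn n0 [z _ <-] hz]]].
exists n, z => ac acL; have := h2 _ acL _ hz.
have np : 0 < n%:R :> R by rewrite ltr0n.
have -> : dot ac.1 (n%:R^-1 *: (iter n g z - z)) - ac.2 =
    (dot ac.1 (iter n g z - z) - n%:R * ac.2) / n%:R.
  by rewrite /dot !coordE; field; rewrite gt_eqF.
rewrite normrM [`|_^-1|]gtr0_norm ?invr_gt0// ler_pdivlMr//; apply: lt_le_trans.
rewrite mulrC -ltr_pdivrMr//; apply: lt_le_trans (Num.Theory.truncnS_gt _) _.
by rewrite ler_nat.
Qed.

Definition fractions (N K : nat) : seq (plane R) :=
  [seq v | m <- iota 1 N,
     v <- [seq m%:R^-1 *: vec (a%:R - K%:R) (b%:R - K%:R) | a <- iota 0 K.*2.+1, b <- iota 0 K.*2.+1]].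

Lemma int_shift (t : R) (K : nat) : t \is a Num.int -> `|t| <= K%:R ->
  exists2 a, a \in iota 0 K.*2.+1 & t = a%:R - K%:R.
Proof.
move=> /intrP[z ->]; rewrite ler_norml => /andP[h1 h2].
have z1 : (- K%:Z <= z)%R by rewrite -(ler_int R) rmorphN.
have z2 : (z <= K%:Z)%R by rewrite -(ler_int R).
exists (absz (z + K%:Z)); first by rewrite mem_iota /=; lia.
have zK : 0 <= z + K%:Z by lia.
by rewrite natr_absz ger0_norm// rmorphD /= addrK.
Qed.

Lemma fractionsP N K m k : (0 < m <= N)%N -> lat k -> `|k| <= K%:R ->
  m%:R^-1 *: k \in fractions N K.
Proof.
move=> /andP[m0 mN] /latP[lx ly] /norm_leP[kx ky].
have [a ain ea] := int_shift lx kx; have [b bin eb] := int_shift ly ky.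
apply/allpairsPdep; exists m, (m%:R^-1 *: k); split=> //.
  by rewrite mem_iota m0 add1n ltnS.
apply/allpairsP; exists (a, b); split=> //=.
by congr (_ *: _); apply: plane_eq; rewrite !coordE.
Qed.

(** A normal vector and the constant term; for equal points, any line through them
will do. *)
Definition line_through (v w : plane R) : plane R * R :=
  let a := if v == w then vec 1 0 else perp (w - v) in (a, dot a v).

Lemma line_through_neq0 v w : (line_through v w).1 != 0.
Proof.
rewrite /line_through /=; case: (eqVneq v w) => [_|vw].
  have : cx (vec 1 0 : plane R) != cx 0 by rewrite !coordE oner_eq0.
  by apply: contraNneq => ->.
by apply: perp_neq0; rewrite subr_eq0 eq_sym.
Qed.

Lemma line_through1 v w : dot (line_through v w).1 v = (line_through v w).2.
Proof. by []. Qed.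

Lemma line_through2 v w : dot (line_through v w).1 w = (line_through v w).2.
Proof.
rewrite /line_through /=; case: (eqVneq v w) => [->//|_].
by apply/eqP; rewrite -subr_eq0 -dotB -det_perp detkk.
Qed.

Lemma direction_bound (L : seq (plane R * R)) : exists A : R, forall ac, ac \in L ->
  `|cx ac.1| + `|cy ac.1| <= A.
Proof.
elim: L => [|ac L [A hA]]; first by exists 0.
exists (Num.max A (`|cx ac.1| + `|cy ac.1|)) => bc; rewrite inE => /orP[/eqP ->|/hA h].
  by rewrite le_max lexx orbT.
by rewrite le_max h.
Qed.

Section Past.
Variables (g h : plane R -> plane R) (E : set (plane R)).
Hypotheses (gh : lift_homeo g h) (hE : noise_set E).

(** Reversal of pseudo-orbits turns futures under [h] into pasts under [g]. *)
Lemma past_basin e : h @` (future h E (g e)) `<=` \bigcup_M basin g E e M.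
Proof.
move=> _ [w [n [k [lk hr]]] <-]; exists n.+1 => //; exists n.+1, (- k).
split=> //; first exact: latN.
have := reach_inv (lift_homeo_sym gh) hE hr.
rewrite (lift_inv_per gh)// (lift_gK gh) => /(reach_lat gh (latN lk)).
by rewrite addrK.
Qed.

End Past.

Section Existence.
Variables (g h : plane R -> plane R) (E : set (plane R)).
Hypotheses (gh : lift_homeo g h) (hE : noise_set E).

(** The future and the past of [e] are full, so they meet by [full_meet], and a
common point closes a loop at [e]. *)
Lemma hub_of_full e : full (future g E e) -> full (future h E (g e)) -> hub g h E e.
Proof.
move=> ff fb; have hg := lift_homeo_sym gh.
have fp : full (h @` future h E (g e)).
  by apply: full_image fb; [exact: lift_inv_cont gh|exact: lift_inv_per gh].
split.
- have Ao : open (future g E e) by exact: (future_open gh hE).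
  have Ai : lat_invariant (future g E e) by exact: future_invariant.
  have Bi : lat_invariant (h @` future h E (g e)).
    move=> _ l ll [v fv <-]; exists (v + l); last exact: (lift_inv_per gh).
    exact: future_invariant.
  have [w [[n [k [lk hr]]] [v [n' [k' [lk' hr']]] vw]]] := full_meet Ao Ai Bi ff fp.
  have := reach_inv hg hE hr'; rewrite (lift_inv_per gh)// (lift_gK gh) vw => r2.
  have := reach_lat gh (latB lk lk') r2; rewrite -addrA [k' + _]addrC subrK => r3.
  have := reach_add hr r3; rewrite addSn => hl.
  by exists (n + n'.+1)%N, (k - k'); split=> //; exact: latB.
- by apply: full_sub fp; exact: (past_basin gh hE).
have fg : full (g @` future g E e).
  by apply: full_image ff; [exact: lift_cont gh|exact: lift_per gh].
by apply: full_sub fg; have := past_basin hg hE (e := g e); rewrite (lift_gK gh).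
Qed.

Lemma not_full_fraction : spreading g -> exists N K (C : R), forall N' K' (C' : R),
  (N <= N')%N -> (K <= K')%N -> C <= C' -> forall x, ~ full (future g E x) ->
  exists2 v, v \in fractions N' K' &
    `|v| <= C' /\ forall n, `|iter n g x - x - n%:R *: v| <= C'.
Proof.
move=> sg; have [N [C hd]] := future_dichotomy gh hE sg.
have [B B0 hB] := iter_displacement gh hE.
exists N, (Num.truncn (N%:R * B + `|C|)).+1, (B + `|C|) => N' K' C' NN' KK' CC' x nf.
have [//|[m [k [/andP[m0 mN] lk hk]]]] := hd x.
have mp : 0 < m%:R :> R by rewrite ltr0n.
have kn : `|k| <= K'%:R.
  have -> : k = (iter m g x - x) - (iter m g x - x - (m%:R / m%:R) *: k).
    by rewrite divff ?gt_eqF// scale1r opprB addrC subrK.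
  apply: le_trans (ler_normB _ _) _.
  apply: (@le_trans _ _ (N%:R * B + `|C|)).
    apply: lerD; last exact: le_trans (hk m) (ler_norm _).
    by apply: le_trans (hB _ _) _; apply: ler_wpM2r; [exact: ltW|rewrite ler_nat].
  by apply: le_trans (ltW (Num.Theory.truncnS_gt _)) _; rewrite ler_nat.
exists (m%:R^-1 *: k).
  by apply: fractionsP => //; rewrite m0 (leq_trans mN).
have hC n : `|iter n g x - x - n%:R *: (m%:R^-1 *: k)| <= `|C|.
  by rewrite scalerA; apply: le_trans (hk n) (ler_norm _).
split; last by move=> n; apply: le_trans (hC n) _; lra.
set v := _ *: k in hC *.
have -> : v = (iter 1 g x - x) - (iter 1 g x - x - 1%:R *: v).
  by rewrite scale1r opprB addrC subrK.
apply: le_trans (ler_normB _ _) _; apply: le_trans CC'; apply: lerD; last exact: hC.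
by apply: le_trans (hB _ _) _; rewrite mul1r.
Qed.

End Existence.

(** Let [j] be the first time at which the orbit of [z] has a full past, or the final
time if there is none. Up to time
[j] the orbit rotates backwards like a vector [v] of a finite set; at time [j]
the future is not full, and the orbit rotates like a vector [w] from then on. So
its displacement is near the line through [- v] and [w], and [spreading]
provides an orbit for which this fails for all such lines. *)
Lemma exists_hub g h E : lift_homeo g h -> noise_set E -> spreading g ->
  exists e, hub g h E e.
Proof.
move=> gh hE sg; have hg := lift_homeo_sym gh.
apply: contrapT => nohub.
have no e : ~ (full (future g E e) /\ full (future h E (g e))).
  by move=> [ff fb]; apply: nohub; exists e; exact: hub_of_full.
have [N1 [K1 [C1 h1]]] := not_full_fraction gh hE sg.
have [N2 [K2 [C2 h2]]] := not_full_fraction hg hE (spreading_inv gh sg).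
pose N := maxn N1 N2; pose K := maxn K1 K2.
pose C := Num.max 0 (Num.max C1 C2).
have C0 : 0 <= C by rewrite le_max lexx.
have {}h1 := h1 N K C (leq_maxl _ _) (leq_maxl _ _) _.
have {}h2 := h2 N K C (leq_maxr _ _) (leq_maxr _ _) _.
have {}h1 := h1 ltac:(by rewrite /C !le_max lexx orbT).
have {}h2 := h2 ltac:(by rewrite /C !le_max lexx !orbT).
have [B B0 hB] := lift_displacement gh.
pose V := fractions N K.
pose L := [seq line_through (- v) w | v <- V, w <- V].
have [A hA] := direction_bound L.
have [|n [z hz]] := sg L (A * (C + B + C)).
  by move=> _ /allpairsP[[v w] [_ _ ->]]; exact: line_through_neq0.
pose X i := iter i g z.
suff [j [v [w [jn vV wV small]]]] : exists j v w, [/\ (j <= n)%N, v \in V, w \in V &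
    `|X n - z - (j%:R *: (- v) + (n - j)%:R *: w)| <= C + B + C].
  have inL : line_through (- v) w \in L by apply/allpairsP; exists (v, w).
  have := hz _ inL; apply/negP; rewrite -leNgt.
  set ac := line_through _ _ in inL *.
  have d1 : dot ac.1 (- v) = ac.2 by exact: line_through1.
  have d2 : dot ac.1 w = ac.2 by exact: line_through2.
  have -> : dot ac.1 (iter n g z - z) - n%:R * ac.2 =
     dot ac.1 (X n - z - (j%:R *: (- v) + (n - j)%:R *: w)).
    have -> : dot ac.1 (X n - z - (j%:R *: (- v) + (n - j)%:R *: w)) =
      dot ac.1 (X n - z) - (j%:R * dot ac.1 (- v) + (n - j)%:R * dot ac.1 w).
      by rewrite /dot !coordE; ring.
    by rewrite d1 d2 natrB//; ring.
  apply: le_trans (norm_dot _ _) _; by apply: ler_pM => //; exact: hA.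
(* a vector describing the inverse iterates of g (X i) describes the way from z *)
have back (i : nat) v : (forall q : nat, `|iter q h (g (X i)) - g (X i) - q%:R *: v| <= C) ->
    `|X i.+1 - z - i.+1%:R *: (- v)| <= C.
  move=> /(_ i.+1); rewrite -[g (X i)]/(iter i.+1 g z) (iter_cancel gh).
  rewrite -normrN; congr (`|_| <= _).
  by apply: plane_eq; rewrite !coordE; ring.
have [Bn|nBn] := pselect (full (future h E (g (X n)))); last first.
  have [v vV [nv hv]] := h2 _ nBn; exists n, v, v; split=> //.
  rewrite subnn scale0r addr0.
  have -> : X n - z - n%:R *: (- v) = (X n.+1 - z - n.+1%:R *: (- v)) - (g (X n) - X n) - v.
    by rewrite -[n.+1%:R]natr1 /X /=; apply: plane_eq; rewrite !coordE; ring.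
  apply: le_trans (ler_normB _ _) _; apply: lerD => //.
  by apply: le_trans (ler_normB _ _) _; apply: lerD => //; exact: back.
have exB : exists i, `[< full (future h E (g (X i))) >] by exists n; apply/asboolP.
have [j /asboolP Bj jmin] := ex_minnP exB.
have jn : (j <= n)%N by apply: jmin; apply/asboolP.
have nF : ~ full (future g E (X j)) by move=> Fj; exact: (no (X j)).
have [w wV [_ hw]] := h1 _ nF.
have fwd : `|X n - X j - (n - j)%:R *: w| <= C.
  by have := hw (n - j)%N; rewrite /X -iterD subnK.
have CBC : 0 <= B by exact: ltW.
case: j Bj jmin jn nF hw fwd => [|j] Bj jmin jn nF hw fwd.
  exists 0%N, w, w; split=> //; rewrite scale0r add0r.
  by apply: le_trans fwd _; lra.
have nB : ~ full (future h E (g (X j))).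
  by move=> Bj'; have := jmin j; rewrite ltnn => H; have := H ltac:(exact/asboolP).
have [v vV [_ /back hv]] := h2 _ nB.
exists j.+1, v, w; split=> //.
have -> : X n - z - (j.+1%:R *: (- v) + (n - j.+1)%:R *: w) =
   (X j.+1 - z - j.+1%:R *: (- v)) + (X n - X j.+1 - (n - j.+1)%:R *: w).
  by apply: plane_eq; rewrite !coordE; ring.
by apply: le_trans (ler_normD _ _) _; have := lerD hv fwd; lra.
Qed.

End Hub.

(** * Euclidean noise and the pseudo-orbit cocycle *)

Section EuclideanNoise.
Variable R : realType.
Implicit Types (p q x y z k l e : plane R) (g h : plane R -> plane R) (E S : set (plane R)).

(** Cauchy and Schwarz, from the square of the determinant. *)
Lemma enorm_triangle p q : enorm (p + q) <= enorm p + enorm q.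
Proof.
rewrite !enormE !coordE.
set a := Num.sqrt (cx p ^+ 2 + _); set b := Num.sqrt (cx q ^+ 2 + _).
have a0 : 0 <= a by exact: sqrtr_ge0.
have b0 : 0 <= b by exact: sqrtr_ge0.
have a2 : a ^+ 2 = cx p ^+ 2 + cy p ^+ 2 by rewrite sqr_sqrtr// addr_ge0// sqr_ge0.
have b2 : b ^+ 2 = cx q ^+ 2 + cy q ^+ 2 by rewrite sqr_sqrtr// addr_ge0// sqr_ge0.
have ab : cx p * cx q + cy p * cy q <= a * b.
  apply: le_trans (ler_norm _) _; rewrite -ler_sqr ?nnegrE ?mulr_ge0//.
  rewrite real_normK ?num_real// exprMn a2 b2.
  have := sqr_ge0 (cx p * cy q - cy p * cx q); lra.
rewrite -(ger0_norm (addr_ge0 a0 b0)) -sqrtr_sqr ler_sqrt; last exact: sqr_ge0.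
rewrite !sqrrD a2 b2; lra.
Qed.

Lemma enormZ (t : R) p : enorm (t *: p) = `|t| * enorm p.
Proof.
rewrite !enormE !coordE !exprMn -mulrDr sqrtrM ?sqr_ge0//.
by rewrite sqrtr_sqr.
Qed.

Lemma enorm_le p : enorm p <= 2 * `|p|.
Proof.
have [h1 h2] := (norm_leP p `|p|).1 (lexx _).
rewrite enormE -(ger0_norm (_ : 0 <= 2 * `|p|)); last by rewrite mulr_ge0.
rewrite -sqrtr_sqr ler_sqrt; last exact: sqr_ge0.
have : cx p ^+ 2 <= `|p| ^+ 2 by rewrite -(real_normK (num_real (cx p))) ler_sqr ?nnegrE.
have : cy p ^+ 2 <= `|p| ^+ 2 by rewrite -(real_normK (num_real (cy p))) ler_sqr ?nnegrE.
have := sqr_ge0 `|p|; rewrite exprMn; lra.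
Qed.

Lemma enorm_noise (eps : R) : 0 < eps -> noise_set [set v : plane R | enorm v < eps].
Proof.
move=> e0; split.
- apply: open_ballP => p /= pe; exists ((eps - enorm p) / 2).
    by rewrite divr_gt0// subr_gt0.
  move=> q qp; rewrite -(subrK p q) addrC; apply: le_lt_trans (enorm_triangle _ _) _.
  have := enorm_le (q - p); lra.
- by rewrite /= -(scale0r 0) enormZ normr0 mul0r.
- by move=> v /=; rewrite -scaleN1r enormZ normrN1 mul1r.
- move=> a b /= ha hb p [t /andP[t0 t1] ->] /=.
  have -> : a + t *: (b - a) = (1 - t) *: a + t *: b.
    by apply: plane_eq; rewrite !coordE; ring.
  apply: le_lt_trans (enorm_triangle _ _) _; rewrite !enormZ (ger0_norm t0).
  rewrite ger0_norm ?subr_ge0//.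
  have [->|t0'] := eqVneq t 0; first by rewrite subr0 mul1r mul0r addr0.
  have tp : 0 < t by rewrite lt_def t0' t0.
  have : t * enorm b < t * eps by rewrite ltr_pM2l.
  have : (1 - t) * enorm a <= (1 - t) * eps.
    by apply: ler_wpM2l; [rewrite subr_ge0|exact: ltW].
  lra.
- exists eps => v /= ve; apply/norm_leP; split.
    by apply: le_trans (ltW ve); exact: coord_le_enorm.
  by apply: le_trans (ltW ve); exact: coord_le_enorm.
Qed.

Lemma iter_noise_shift n (x : int -> torus R) (i : int) : iter n (@Defs.shift R) x i = x (i + n%:Z).
Proof.
elim: n i => [|n IH] i; first by rewrite addr0.
by rewrite iterS /Defs.shift IH -addrA; congr x; rewrite -[n.+1]addn1 PoszD [1 + _]addrC.
Qed.

Lemma fiber_iter_ext g (eps : R) n (x x' : int -> torus R) p :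
  (forall i, (i < n)%N -> x i%:Z = x' i%:Z) ->
  fiber_iter g eps n x p = fiber_iter g eps n x' p.
Proof.
elim: n => [//|n IH] h /=; rewrite /fiber_map IH; last by move=> i ni; apply/h/ltnW.
by rewrite !iter_noise_shift !add0r h.
Qed.

Lemma torus_ball_enorm (eps : R) (v : plane R) :
  enorm v < eps -> torus_ball (torus_pi 0) eps (torus_pi v).
Proof.
move=> ve; rewrite /torus_ball /= /torus_dist; apply: le_lt_trans ve.
apply: ge_inf; first by exists 0 => _ [u [w [_ _ ->]]]; exact: sqrtr_ge0.
exists 0, v; split=> //.
by rewrite sub0r -scaleN1r enormZ normrN1 mul1r.
Qed.

Lemma small_lift_pi (eps : R) (v : plane R) : eps <= 2^-1 -> enorm v < eps ->
  small_lift eps (torus_pi v) = v.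
Proof.
move=> e2 ve; have [h1 h2] := small_liftP (torus_ball_enorm ve).
exact: small_lift_uniq e2 h1 ve h2.
Qed.

(** For [eps] at most 1/2 a noise in the torus and its small lift determine each
other; the bi-infinite noise sequence is only read at times 0 to n - 1. *)
Lemma displacement_setE g (eps : R) n : 0 < eps -> eps <= 2^-1 ->
  displacement_set g eps n = pseudo_displacements g [set v : plane R | enorm v < eps] n.
Proof.
move=> e0 e2; set E := [set v : plane R | _].
have E0 : E 0 by rewrite /E/= -(scale0r 0) enormZ normr0 mul0r.
have to_reach (x : int -> torus R) p m : noise_space eps x ->
    reach g E m p (fiber_iter g eps m x p).
  move=> xE; elim: m => [//|m IH]; exists (fiber_iter g eps m x p) => //=.
  rewrite /fiber_map addrAC subrr add0r iter_noise_shift.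
  by have [] := small_liftP (xE (0 + m%:Z)).
have of_reach p m y : reach g E m p y ->
    exists2 x : int -> torus R, noise_space eps x & fiber_iter g eps m x p = y.
  elim: m y => [|m IH] y.
    by move=> ->; exists (fun=> torus_pi 0) => // i; exact: torus_ball_enorm.
  move=> [z /IH[x xE xz] Ey].
  pose x' (i : int) := if i == m%:Z then torus_pi (y - g z) else x i.
  exists x' => [i|].
    by rewrite /x'; case: eqP => _; [exact: torus_ball_enorm|exact: xE].
  rewrite /= /fiber_map (@fiber_iter_ext _ _ _ _ x) ?xz.
    by rewrite iter_noise_shift add0r /x' eqxx small_lift_pi// addrC subrK.
  by move=> i im; rewrite /x' eqz_nat ltn_eqF.
apply/seteqP; split=> [_ [x [p [xE ->]]]|_ [x [y [/of_reach[s sE <-] ->]]]].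
  by exists p, (fiber_iter g eps n x p); split=> //; exact: to_reach.
by exists s, x.
Qed.

End EuclideanNoise.

(** * Torus maps homotopic to the identity, and conservative maps *)

Section TorusTopology.
Variable R : realType.
Implicit Types (p q v w a b l : plane R).

Lemma torus_pi_surj (t : torus R) : exists v, torus_pi v = t.
Proof. by exists (repr t); exact: reprK. Qed.

Lemma torus_piD v l : lat l -> torus_pi (v + l) = torus_pi v.
Proof. by move=> ll; apply/torus_pi_lat; rewrite addrAC subrr add0r. Qed.

Lemma torus_pi_eq v w : torus_pi v = torus_pi w -> exists2 l, lat l & v = w + l.
Proof. by move=> /torus_pi_lat h; exists (v - w) => //; rewrite addrC subrK. Qed.

Lemma torus_pi_continuous : continuous (@torus_pi R).
Proof. exact: pi_continuous. Qed.

Lemma torus_nbhs p (r : R) : 0 < r ->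
  nbhs (torus_pi p) [set t | exists2 v, `|v - p| < r & torus_pi v = t].
Proof.
move=> r0; apply: open_nbhs_nbhs; split; last first.
  by exists p => //; rewrite subrr normr0.
suff : open (@torus_pi R @^-1` [set t | exists2 v, `|v - p| < r & torus_pi v = t]) by [].
apply: open_ballP => w [v vp /torus_pi_eq[l ll vw]].
exists (r - `|v - p|) => [|w' ww']; first by rewrite subr_gt0.
exists (w' + l); last exact: torus_piD.
have -> : w' + l - p = (w' - w) + (v - p) by rewrite vw; apply: plane_eq; rewrite !coordE; ring.
by apply: le_lt_trans (ler_normD _ _) _; lra.
Qed.

(** Two lifts of the same point at distance less than 1 coincide; the distance is
estimated through the two intermediate points. *)
Lemma lift_near v w v' w' (c c' : R) : torus_pi v = torus_pi w ->
  `|v - v'| < c -> `|v' - w'| < c' -> `|w' - w| < 1 - c - c' -> v = w.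
Proof.
move=> /torus_pi_lat h h1 h2 h3; apply/eqP; rewrite -subr_eq0; apply/eqP.
apply: lat_small => //.
have -> : v - w = (v - v') + (v' - w') + (w' - w) by rewrite !addrA !subrK.
apply: le_lt_trans (ler_normD _ _) _.
by apply: le_lt_trans (lerD (ler_normD _ _) (lexx _)) _; lra.
Qed.

Lemma torus_map_near (F : torus R -> torus R) v w (e : R) : 0 < e ->
  {for torus_pi v, continuous F} -> torus_pi w = F (torus_pi v) ->
  exists2 r : R, 0 < r & forall v', `|v' - v| < r ->
    exists2 w', `|w' - w| < e & torus_pi w' = F (torus_pi v').
Proof.
move=> e0 Fc wF; have := torus_nbhs w e0; rewrite wF => /Fc /torus_pi_continuous.
by move=> /nbhs_plane.
Qed.

(** The map [f1] sends [v] to the lift of [F1 v] closest to [f0 v]. It moves under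
deck transformations exactly as [f0] does. *)
Lemma lift_close (F0 F1 : torus R -> torus R) (f0 : plane R -> plane R) :
  continuous f0 -> (forall v, torus_pi (f0 v) = F0 (torus_pi v)) -> continuous F1 ->
  (forall v, exists a b, [/\ torus_pi a = F0 (torus_pi v), torus_pi b = F1 (torus_pi v) &
     `|a - b| < 4^-1 ]) ->
  exists f1, [/\ continuous f1, forall v, torus_pi (f1 v) = F1 (torus_pi v) &
    forall v l, lat l -> f1 (v + l) - f1 v = f0 (v + l) - f0 v].
Proof.
move=> f0c f0F F1c close.
have q0 : 0 < 4^-1 :> R by rewrite invr_gt0.
have q4 : 4^-1 + 4^-1 + 4^-1 + 4^-1 = 1 :> R by lra.
have /boolp.choice[f1 hf1] : forall v, exists w, torus_pi w = F1 (torus_pi v) /\ `|w - f0 v| < 4^-1.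
  move=> v; have [a [b [aF bF ab]]] := close v.
  have [l ll al] : exists2 l, lat l & f0 v = a + l by apply: torus_pi_eq; rewrite f0F aF.
  exists (b + l); split; first by rewrite torus_piD.
  by rewrite al opprD addrACA subrr addr0 distrC.
have f1F v := (hf1 v).1; have f1c v := (hf1 v).2.
exists f1; split=> //.
- apply/plane_continuousP => v e e0.
  pose e' := Num.min e 4^-1; have e'0 : 0 < e' by rewrite lt_min e0.
  have [r r0 hr] := torus_map_near e'0 (F1c _) (f1F v).
  have [r' r'0 hr'] := (plane_continuousP f0).1 f0c v _ q0.
  exists (Num.min r r'); first by rewrite lt_min r0.
  move=> v'; rewrite lt_min => /andP[/hr[u uv uF] /hr' fv].
  suff -> : f1 v' = u by apply: lt_le_trans uv _; rewrite ge_min lexx.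
  apply: (@lift_near _ _ (f0 v') (f0 v) 4^-1 4^-1) => //; first by rewrite f1F uF.
  have -> : f0 v - u = - ((u - f1 v) + (f1 v - f0 v)) by rewrite addrA subrK opprB.
  rewrite normrN; apply: le_lt_trans (ler_normD _ _) _.
  have := f1c v; have : `|u - f1 v| < 4^-1 by apply: lt_le_trans uv _; rewrite ge_min lexx orbT.
  lra.
move=> v l ll; set t := f0 (v + l) - f0 v.
have lt : lat t by apply/torus_pi_lat; rewrite !f0F torus_piD.
suff -> : f1 (v + l) = f1 v + t by rewrite addrAC subrr add0r.
apply: (@lift_near _ _ (f0 (v + l)) (f0 (v + l)) 4^-1 4^-1) => //.
- by rewrite torus_piD// !f1F torus_piD.
- by rewrite subrr normr0.
have -> : f0 (v + l) - (f1 v + t) = - (f1 v - f0 v).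
  by rewrite /t; apply: plane_eq; rewrite !coordE; ring.
by rewrite normrN; have := f1c v; lra.
Qed.

(** The displacement is continuous with integer values, hence constant. *)
Lemma lift_id_per (f : plane R -> plane R) : continuous f ->
  (forall v, torus_pi (f v) = torus_pi v) -> forall v l, f (v + l) - f v = l.
Proof.
move=> fc fE; pose d v := f v - v.
have ld v : lat (d v) by apply/torus_pi_lat.
have half : 0 < 2^-1 :> R by rewrite invr_gt0.
have loc v : exists2 r : R, 0 < r & forall w, `|w - v| < r -> d w = d v.
  have [r r0 hr] := (plane_continuousP f).1 fc v _ half.
  exists (Num.min r 2^-1) => [|w]; first by rewrite lt_min r0.
  rewrite lt_min => /andP[/hr h1 h2]; apply/eqP; rewrite -subr_eq0; apply/eqP.
  apply: lat_small; first exact: latB.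
  have -> : d w - d v = (f w - f v) - (w - v) by rewrite /d; apply: plane_eq; rewrite !coordE; ring.
  by apply: le_lt_trans (ler_normB _ _) _; lra.
have cT : connected (@setT (plane R)) by exact: convex_connected.
move=> v l.
suff dd : d (v + l) = d v.
  have -> : f (v + l) - f v = d (v + l) - d v + l by rewrite /d; apply: plane_eq; rewrite !coordE; ring.
  by rewrite dd subrr add0r.
have sep (Q : plane R -> Prop) : (forall u u', d u = d u' -> Q u -> Q u') -> open [set u | Q u].
  move=> hQ; apply: open_ballP => u /= Qu; have [r r0 hr] := loc u.
  by exists r => // w /hr dw; apply: hQ Qu.
suff E : [set u | d u = d v] = setT.
  by have : [set u | d u = d v] (v + l) by rewrite E.
apply: cT; first by exists v.
- by exists [set u | d u = d v]; [apply: sep => u u' ->|rewrite setTI].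
- exists [set u | d u = d v]; last by rewrite setTI.
  have -> : [set u | d u = d v] = ~` [set u | d u <> d v].
    by apply/seteqP; split=> u /= h; [move=> /(_ h)|exact: contrapT].
  by apply: open_closedC; apply: sep => u u' ->.
Qed.

(** Joint continuity of the homotopy, stated without the subspace topology. *)
Lemma homotopy_near (H : R * torus R -> torus R) s t V :
  {within `[0, 1]%classic `*` setT, continuous H} -> 0 <= s <= 1 -> nbhs (H (s, t)) V ->
  exists2 r : R, 0 < r & exists2 B, nbhs t B & forall s' t', 0 <= s' <= 1 ->
    `|s' - s| < r -> B t' -> V (H (s', t')).
Proof.
move=> Hc s01 HV.
have Ast : (`[0, 1]%classic `*` setT) (s, t) by split=> //=; rewrite in_itv.
have := (subspace_continuousP _ _).1 Hc (s, t) Ast V HV.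
move=> [[B1 B2] /= [/nbhs_ballP[r /= r0 hr] nB2] sub].
exists r => //; exists B2 => // s' t' s'01 s's Bt'.
apply: (sub (s', t')); last by split=> //=; rewrite in_itv.
by split=> //=; apply: hr; rewrite /ball/= distrC.
Qed.

(** The deck displacements of lifts of two nearby stages of the homotopy agree by
[lift_close]. Since the interval is connected, those of [gt] agree with those of
a lift of the identity. *)
Lemma lift_equivariant (g : torus R -> torus R) (gt : plane R -> plane R) :
  continuous g -> homotopic R g id -> is_lift g gt ->
  forall p l, lat l -> gt (p + l) = gt p + l.
Proof.
move=> gc [H [Hc H0 H1]] [gtc gtg].
pose F (s : R) t := H (s, t).
have Fc s : 0 <= s <= 1 -> continuous (F s).
  move=> s01 t V FV; have [r r0 [B nB hB]] := homotopy_near Hc s01 FV.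
  by apply: filterS nB => t' Bt'; apply: hB => //; rewrite subrr normr0.
pose P (s : R) := exists f, [/\ continuous f, forall v, torus_pi (f v) = F s (torus_pi v) &
  forall v l, lat l -> f (v + l) - f v = gt (v + l) - gt v].
have e8 : 0 < 8^-1 :> R by rewrite invr_gt0.
have loc s0 : 0 <= s0 <= 1 -> exists2 d : R, 0 < d & forall s s',
    0 <= s <= 1 -> 0 <= s' <= 1 -> `|s - s0| < d -> `|s' - s0| < d -> P s -> P s'.
  move=> s001.
  have [||d d0 hd] := @unit_square_uniform R (fun d v => exists c, forall s, 0 <= s <= 1 ->
     `|s - s0| < d -> exists2 a, `|a - c| < 8^-1 & torus_pi a = F s (torus_pi v)).
  - move=> d d' v dd' [c hc]; exists c => s s01 sd; apply: hc => //.
    exact: lt_le_trans dd'.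
  - move=> v; have [c cE] := torus_pi_surj (F s0 (torus_pi v)).
    have := torus_nbhs c e8; rewrite cE => nV.
    have [r r0 [B /torus_pi_continuous/nbhs_plane[r' r'0 hr'] hB]] := homotopy_near Hc s001 nV.
    exists (Num.min r r') => [|v']; first by rewrite lt_min r0.
    rewrite lt_min => /andP[_ /hr' Bv']; exists c => s s01; rewrite lt_min => /andP[sr _].
    by have := hB s (torus_pi v') s01 sr Bv'.
  exists d => // s s' s01 s'01 sd s'd [f [fc fF fper]].
  have [|f1 [f1c f1F f1per]] := lift_close fc fF (Fc _ s'01).
    move=> v; have [l ll /hd[c hc]] := lat_floor v.
    have [a ac aF] := hc s s01 sd; have [b bc bF] := hc s' s'01 s'd.
    rewrite torus_piD in aF; last exact: latN.
    rewrite torus_piD in bF; last exact: latN.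
    exists a, b; split=> //; have -> : a - b = (a - c) - (b - c) by rewrite opprB addrA subrK.
    by apply: le_lt_trans (ler_normB _ _) _; lra.
  by exists f1; split=> // v l ll; rewrite f1per// fper.
have P0 : P 0 by exists gt; split=> // v; rewrite gtg /F H0.
have openP (Q : R -> Prop) : (forall s0, 0 <= s0 <= 1 -> exists2 d : R, 0 < d & forall s s',
    0 <= s <= 1 -> 0 <= s' <= 1 -> `|s - s0| < d -> `|s' - s0| < d -> Q s -> Q s') ->
    exists2 V : set R, open V & [set s | 0 <= s <= 1 /\ Q s] = `[0, 1]%classic `&` V.
  move=> hQ; exists [set s | exists s0 (d : R), [/\ 0 <= s0 <= 1, Q s0, 0 < d, `|s - s0| < d &
      forall s', 0 <= s' <= 1 -> `|s' - s0| < d -> Q s']].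
    rewrite openE => s [s0 [d [s01 Qs0 d0 sd hd]]]; apply/nbhs_ballP.
    exists (d - `|s - s0|) => /=; first by rewrite subr_gt0.
    move=> u; rewrite /ball/= => us; exists s0, d; split=> //.
    have -> : u - s0 = (s - s0) - (s - u) by ring.
    by apply: le_lt_trans (ler_normB _ _) _; lra.
  apply/seteqP; split=> [s [s01 Qs]|s [s01 [s0 [d [s001 Qs0 d0 sd hd]]]]].
    split; first by rewrite /= in_itv.
    have [d d0 hd] := hQ s s01; exists s, d; split=> //; first by rewrite subrr normr0.
    by move=> s' s'01 s's; apply: (hd s) => //; rewrite subrr normr0.
  by move: s01; rewrite /= in_itv /= => s01; split=> //; exact: hd.
have [V Vo PV] := openP P loc.
have [Q Qo PQ] : exists2 V : set R, open V &
    [set s | 0 <= s <= 1 /\ ~ P s] = `[0, 1]%classic `&` V.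
  apply: openP => s0 s001; have [d d0 hd] := loc s0 s001.
  by exists d => // s s' s01 s'01 sd s'd nP Ps'; apply: nP; apply: (hd s' s).
have E : [set s | 0 <= s <= 1 /\ P s] = `[0, 1]%classic.
  apply: (@segment_connected R 0 1).
  - by exists 0; split=> //; rewrite lexx ler01.
  - by exists V.
  - exists (~` Q); first exact: open_closedC.
    apply/seteqP; split=> [s [s01 Ps]|s [s01 nO]].
      split; first by rewrite /= in_itv.
      move=> Qs; have : [set s | 0 <= s <= 1 /\ ~ P s] s.
        by rewrite PQ; split=> //; rewrite /= in_itv.
      by case.
    have s01' : 0 <= s <= 1 by move: s01; rewrite /= in_itv.
    split=> //; apply: contrapT => nPs; apply: nO.
    by have : [set s | 0 <= s <= 1 /\ ~ P s] s; [|rewrite PQ => -[]].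
have [_ [f [fc fF fper]]] : [set s | 0 <= s <= 1 /\ P s] 1.
  by rewrite E /= in_itv /= lexx ler01.
move=> p l ll.
have := fper p l ll; rewrite lift_id_per//; last by move=> v; rewrite fF /F H1.
by move=> lE; rewrite -[LHS](subrK (gt p)) -lE addrC.
Qed.

(** Equivariance makes the lift bijective. Its inverse is continuous because it
lifts a continuous map: a lift of a nearby point that is near [h y] is mapped
near [y], so it is the preimage. *)
Lemma lift_homeo_of_homotopy (g : torus R -> torus R) (gt : plane R -> plane R) :
  homeomorphism g -> homotopic R g id -> is_lift g gt -> exists h, lift_homeo gt h.
Proof.
move=> [gc [gi [gic giK gKi]]] gid gl.
have per := lift_equivariant gc gid gl; have [gtc gtg] := gl.
have inj : injective gt.
  move=> v w vw.
  have [l ll vE] : exists2 l, lat l & v = w + l.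
    by apply: torus_pi_eq; apply: (can_inj giK); rewrite -!gtg vw.
  move: vw; rewrite vE per// => /eqP; rewrite -subr_eq0 addrAC subrr add0r => /eqP ->.
  by rewrite addr0.
have surj y : exists v, gt v = y.
  have [v vE] := torus_pi_surj (gi (torus_pi y)).
  have [l ll yE] : exists2 l, lat l & y = gt v + l.
    by apply: torus_pi_eq; rewrite gtg vE gKi.
  by exists (v + l); rewrite per.
have /boolp.choice[h hK] := surj.
have gK : cancel gt h by move=> v; apply: inj; rewrite hK.
exists h; split=> //.
apply/plane_continuousP => y e e0.
have half : 0 < 2^-1 :> R by rewrite invr_gt0.
have [r r0 hr] := (plane_continuousP gt).1 gtc (h y) _ half.
pose e' := Num.min e r; have e'0 : 0 < e' by rewrite lt_min e0.
have hpi v : torus_pi (h v) = gi (torus_pi v) by rewrite -{2}(hK v) gtg giK.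
have [d d0 hd] := torus_map_near e'0 (gic _) (hpi y).
exists (Num.min d 2^-1) => [|z]; first by rewrite lt_min d0.
rewrite lt_min => /andP[/hd[w wy wE] zy].
suff -> : h z = w by apply: lt_le_trans wy _; rewrite ge_min lexx.
apply: inj; rewrite hK; apply/eqP; rewrite -subr_eq0; apply/eqP; apply: lat_small.
  by apply/torus_pi_lat; rewrite gtg wE gKi.
have wr : `|w - h y| < r by apply: lt_le_trans wy _; rewrite ge_min lexx orbT.
have := hr _ wr; rewrite hK => gw.
have -> : z - gt w = (z - y) - (gt w - y) by rewrite opprB addrA subrK.
by apply: le_lt_trans (ler_normB _ _) _; lra.
Qed.

Section Conservative.
Variables (g : torus R -> torus R) (gt h : plane R -> plane R) (E : set (plane R)).
Hypotheses (gh : lift_homeo gt h) (hE : noise_set E).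
Hypotheses (gtg : forall v, torus_pi (gt v) = g (torus_pi v)) (gcons : conservative g).

Lemma iter_lift n v : torus_pi (iter n gt v) = iter n g (torus_pi v).
Proof. by elim: n => [//|n IH] /=; rewrite gtg IH. Qed.

(** Take a point near [p] that returns near [p] at time [n]. The noise is used at the
first step to join the orbit of that point, and at the last step to land on [q];
when [n = 1] both corrections are made in the same step. *)
Lemma conservative_local : exists2 rho : R, 0 < rho & forall p q, `|q - p| < rho ->
  future gt E p q.
Proof.
have [r r0 hr'] := noise_near hE (noise0 hE).
have hr v : `|v| < r -> E v by move=> vr; apply: hr'; rewrite subr0.
exists (r / 4) => [|p q pq]; first by rewrite divr_gt0.
have r4 : 0 < r / 4 by rewrite divr_gt0.
have [d d0 hd] := (plane_continuousP gt).1 (lift_cont gh) p _ r4.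
pose d' := Num.min d (r / 4); have d'0 : 0 < d' by rewrite lt_min d0.
have : nonwandering_set g (torus_pi p) by rewrite gcons.
move=> /(_ _ (torus_nbhs p d'0))[n [n0 [t [[_ [x xp <-] xt] [y yp yt]]]]].
have [l ll ly] : exists2 l, lat l & iter n gt x = y + l.
  by apply: torus_pi_eq; rewrite iter_lift xt yt.
have xd : `|x - p| < d by apply: lt_le_trans xp _; rewrite ge_min lexx.
have yr : `|y - p| < r / 4 by apply: lt_le_trans yp _; rewrite ge_min lexx orbT.
have gx := hd _ xd.
case: n n0 xt ly => [//|[|n]] _ xt ly.
  exists 0%N, l; split=> //; apply/reach1; apply: hr.
  have -> : q + l - gt p = (q - p) - (y - p) + (gt x - gt p).
    by rewrite /= in ly; rewrite ly; apply: plane_eq; rewrite !coordE; ring.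
  apply: le_lt_trans (ler_normD _ _) _.
  by apply: le_lt_trans (lerD (ler_normB _ _) (lexx _)) _; lra.
exists n.+1, l; split=> //.
exists (iter n.+1 gt x).
  apply: (@reach_cons _ _ _ _ _ (gt x)).
    by apply: hr; apply: lt_trans gx _; lra.
  by rewrite iterSr; exact: (reach_orbit _ _ gh hE).
apply: hr; rewrite -iterS ly.
have -> : q + l - (y + l) = (q - p) - (y - p) by apply: plane_eq; rewrite !coordE; ring.
by apply: le_lt_trans (ler_normB _ _) _; lra.
Qed.

Lemma future_trans p q w : future gt E p q -> future gt E q w -> future gt E p w.
Proof.
move=> [n [k [lk hr]]] qw.
have : future gt E (q + k) w.
  have [m [l [ll hm]]] := qw; exists m, (l + k); split; first exact: latD.
  by rewrite addrA; exact: (reach_lat gh).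
exact: (future_reach hr).
Qed.

(** Walk from [p] to [q] along a segment by small steps. *)
Lemma conservative_future p : future gt E p = setT.
Proof.
have [rho rho0 near] := conservative_local.
suff walk n q : `|q - p| < n.+1%:R * rho -> future gt E p q.
  apply/seteqP; split=> // q _; apply: (walk (Num.truncn (`|q - p| / rho))).
  by rewrite -ltr_pdivrMr//; exact: Num.Theory.truncnS_gt.
elim: n q => [|n IH] q hq; first by apply: near; rewrite mul1r in hq.
have n1 : 0 < n.+1%:R :> R by rewrite ltr0n.
have n2 : 0 < n.+2%:R :> R by rewrite ltr0n.
have E2 : n.+2%:R = n.+1%:R + 1 :> R by rewrite natr1.
apply: (@future_trans _ (p + (n.+1%:R / n.+2%:R) *: (q - p))).
  apply: IH; rewrite addrAC subrr add0r normrZ gtr0_norm ?divr_gt0//.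
  by rewrite mulrAC ltr_pdivrMr// mulrAC -mulrA ltr_pM2l// mulrC.
apply: near.
have -> : q - (p + (n.+1%:R / n.+2%:R) *: (q - p)) = n.+2%:R^-1 *: (q - p).
  have -> : n.+1%:R = n.+2%:R - 1 :> R by rewrite E2 addrK.
  by apply: plane_eq; rewrite !coordE; field; rewrite gt_eqF.
by rewrite normrZ gtr0_norm ?invr_gt0// mulrC ltr_pdivrMr// mulrC.
Qed.

Lemma conservative_hub e : hub gt h E e.
Proof.
apply: hub_of_full => //; first by rewrite conservative_future; exact: fullT.
suff -> : future h E (gt e) = setT by exact: fullT.
apply/seteqP; split=> // w _.
have [n [k [lk hr]]] : future gt E (h w) e by rewrite conservative_future.
have := reach_lat (lift_homeo_sym gh) (latN lk) (reach_inv gh hE hr).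
rewrite (lift_per gh)// addrK (lift_hK gh) => hr'.
by exists n, (- k); split=> //; exact: latN.
Qed.

End Conservative.
End TorusTopology.

Theorem theorem1p3 (R : realType) (g : torus R -> torus R)
    (gt : plane R -> plane R) (eps : R) :
  homeomorphism g ->
  homotopic R g id ->
  is_lift g gt ->
  0 < eps < 2^-1 ->
  conservative g \/ interior (rotation_set gt) !=set0 ->
  convex_set (pseudo_orbit_rotation_set gt eps).
Proof.
move=> ghom gid gl /andP[e0 e2] hyp.
have [h gh] := lift_homeo_of_homotopy ghom gid gl.
have hE := enorm_noise e0.
have [e he] : exists e, hub gt h [set v : plane R | enorm v < eps] e.
  case: hyp => [gcons|/spreading_interior]; last exact: exists_hub gh hE.
  by exists 0; apply: (conservative_hub gh hE _ gcons); have [] := gl.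
have := hub_convex gh hE he; congr (convex_set (limit_set _)).
by apply/funext => n; rewrite displacement_setE// ltW.
Qed.
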